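(* Consider the $4$-state generalized clock model on the binary tree with $\lambda_1=1/2$, which is the critical value for robust phase transition. Then the spin model has Gibbs measures with single-site marginals different from the equidistribution on $\{0,1,2,3\}$ if and only if $\lambda_2\in(1/3,1/2)$.
   Context: Tree and cutsets. $T=(V,E)$ is the rooted binary tree with root $o$ (every vertex has exactly two children), and $|v|$ is the graph distance from $v$ to $o$. A cutset $C$ is a finite set of vertices such that every self-avoiding infinite path starting from $o$ intersects $C$, and such that there are no $x,y\in C$ with $|x|<|y|$ and $x$ lying on the shortest path from $o$ to $y$. $C^i$ denotes the finite component of $T\setminus C$ (the one containing $o$, when $o\notin C$). $4$-state generalized clock model. The local state space is $\Omega_0=\{0,1,2,3\}$. The transfer matrix $M$ is a $4\times4$ stochastic circulant matrix with strictly positive entries, $M(k,l)=r_{l-k \bmod 4}$, with first row $$r_0=\tfrac14(1+2\lambda_1+\lambda_2),\quad r_1=r_3=\tfrac14(1-\lambda_2),\quad r_2=\tfrac14(1-2\lambda_1+\lambda_2),$$ where $1,\lambda_1,\lambda_2$ are its eigenvalues ($\lambda_1$ appearing twice). $M$ is assumed non-increasing: $M(i,j)\le M(k,l)$ whenever $d(i,j)\ge d(k,l)$, with $d(k,l)=1-\cos(2\pi(k-l)/4)$. The pair potential is $\Phi(i,j)=-\log M(i,j)$. Gibbs measures. For a cutset $C$ and $\delta\in\Omega_0^V$, the finite-volume Gibbs measure on $\Omega_0^{C^i}$ with boundary condition $\delta$ is $$\mu_C^{\Phi,\delta}(\omega)=\frac1Z\exp\Big(-\sum_{\{x,y\}\in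 E:\,x,y\in C^i}\Phi(\omega_x,\omega_y)-\sum_{\{x,y\}\in E:\,x\in C^i,\,y\in C}\Phi(\omega_x,\delta_y)\Big),$$ with $Z$ the normalizing constant. A probability measure $\mu$ on $\Omega_0^V$ is a Gibbs measure if for every cutset $C$ its conditional distribution on $C^i$ given the configuration $\delta$ outside $C^i$ is $\mu_C^{\Phi,\delta}$. Robust phase transition. For $u\in(0,1]$ and a cutset $C$, let $p^{u}_{C}$ be the marginal distribution at the root $o$ of the finite-volume Gibbs measure on $\Omega_0^{C^i}$ with boundary condition identically $0$, where the potential is $\Phi$ on edges inside $C^i$ and $u\Phi$ on edges connecting $C$ to $C^i$. The model exhibits a robust phase transition if for every $u\in(0,1]$ one has $\inf_C\|p^u_C-\mathbf 1\|_\infty\neq 0$, where the infimum is over all cutsets $C$ and $\mathbf 1$ is the equidistribution on $\Omega_0$. The critical value for robust phase transition on the binary tree is $\lambda_1=1/2$ in the sense that there is a robust phase transition if $2\lambda_1>1$ and none if $2\lambda_1<1$.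
   Formalization: The eigenvalue λ₁ is required to have multiplicity exactly two, which at λ₁ = 1/2 excludes only the Potts case λ₂ = 1/2, where Gibbs measures with non-uniform single-site marginals exist and the stated equivalence would fail. *)

(* Defs.v *)
From HB Require Import structures.
From mathcomp Require Import all_boot all_order all_algebra finmap.
From mathcomp Require Import all_classical all_reals all_analysis.

Set Implicit Arguments.
Unset Strict Implicit.
Unset Printing Implicit Defensive.

Import Order.TTheory GRing.Theory Num.Theory.
Import numFieldNormedType.Exports.

Local Open Scope classical_set_scope.
Local Open Scope ring_scope.

(* A vertex is the word of left/right choices leading to it from the root, so
   that its distance to the root is its size, and the shortest path from the
   root to y consists of the prefixes of y. *)
Notation vertex := (seq bool).

Definition origin : vertex := [::].

Definition child (x y : vertex) : bool := [exists b : bool, y == rcons x b].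

Definition adj (x y : vertex) : bool := child x y || child y x.

Definition ray (p : nat -> vertex) : Prop :=
  [/\ p 0%N = origin, injective p & forall n, adj (p n) (p n.+1)].

Definition cutset (C : {fset vertex}) : Prop :=
  (forall p, ray p -> exists n, p n \in C) /\
  ~ exists x y : vertex,
      [/\ x \in C, y \in C, (size x < size y)%N & prefix x y].

(* The connected component of the root in the graph T \ C (empty if the root
   lies in C); it is finite when C is a cutset. *)
Definition interior (C : {fset vertex}) : {fset vertex} :=
  fset_set [set x : vertex | exists p : seq vertex,
    [/\ path adj origin p, last origin p = x
      & all (predC (mem C)) (origin :: p)]].

Notation spin := 'I_4.
HB.instance Definition _ := isPointed.Build 'I_4 ord0.

Notation configuration := (vertex -> spin).

Definition cylinders (D : set vertex) : set (set configuration) :=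
  [set A | exists2 v, D v & exists k : spin, A = [set w | w v = k]].

Definition config_space := g_sigma_algebraType (cylinders setT).

Section Model.
Context {R : realType}.
Variables lambda1 lambda2 : R.

Definition first_row (k : spin) : R :=
  match val k with
  | 0%N => 4%:R^-1 * (1 + 2%:R * lambda1 + lambda2)
  | 2 => 4%:R^-1 * (1 - 2%:R * lambda1 + lambda2)
  | _ => 4%:R^-1 * (1 - lambda2)
  end.

(* [l - k] is the subtraction of 'I_4, i.e. modulo 4. *)
Definition M : 'M[R]_4 := \matrix_(k < 4, l < 4) first_row (l - k).

Definition dist (k l : spin) : R :=
  1 - cos (2%:R * pi * ((val k)%:R - (val l)%:R) / 4%:R).

(* By construction M is stochastic, with eigenvalues 1, lambda1, lambda1 and
   lambda2. That lambda1 appears exactly twice is a genuine condition: it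
   excludes the Potts case lambda2 = lambda1, where M has a triple eigenvalue. *)
Definition generalized_clock_model : Prop :=
  [/\ forall i j, 0 < M i j,
      forall i j k l, dist k l <= dist i j -> M i j <= M k l
    & \rank (eigenspace M lambda1) = 2%N].

Definition Phi (i j : spin) : R := - ln (M i j).

(* In the first double sum every edge inside C^i is met once, as it joins a
   vertex to one of its children. *)
Definition energy (C : {fset vertex}) (delta : configuration)
    (omega : {ffun interior C -> spin}) : R :=
  \sum_(x : interior C) \sum_(y : interior C | child (val x) (val y))
     Phi (omega x) (omega y) +
  \sum_(x : interior C) \sum_(y : C | adj (val x) (val y))
     Phi (omega x) (delta (val y)).

Definition partition_function (C : {fset vertex}) (delta : configuration) : R :=
  \sum_(omega : {ffun interior C -> spin}) expR (- energy delta omega).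

Definition finite_volume_gibbs (C : {fset vertex}) (delta : configuration)
    (omega : {ffun interior C -> spin}) : R :=
  expR (- energy delta omega) / partition_function C delta.

(* [finite_volume_gibbs C delta] is a version of the conditional distribution
   of the spins in C^i given the sigma-algebra of the spins outside C^i. *)
Definition gibbs_measure (mu : probability config_space R) : Prop :=
  forall C : {fset vertex}, cutset C ->
  forall (omega : {ffun interior C -> spin}) (A : set config_space),
    <<s cylinders (~` [set` interior C]) >> A ->
    mu ([set w | forall x : interior C, w (val x) = omega x] `&` A) =
    (\int[mu]_(delta in A) (finite_volume_gibbs delta omega)%:E)%E.

Definition marginal (mu : probability config_space R) (v : vertex)
    (k : spin) : \bar R :=
  mu [set w | w v = k].

Definition equidistribution (k : spin) : \bar R := (4%:R^-1)%:E.

End Model.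

(* Main.v *)
Require Import Defs.
From HB Require Import structures.
From mathcomp Require Import all_boot all_order all_algebra finmap.
From mathcomp Require Import all_classical all_reals all_analysis.
From mathcomp Require Import measurable_realfun ring lra.

(* Identify the spins with pairs of signs (sigma, tau), so that a function on
   the spins reads h = n + s sigma + t tau + z sigma tau; then M halves s and t
   and multiplies z by lambda2.  The messages sent from the boundary towards
   the root are updated by (m1, m2) |-> M (m1 m2).  This map is bilinear, so
   that it preserves a polyhedral cone as soon as it does so on pairs of
   extreme rays.

   For lambda2 <= 1/3 consider the cone spanned by the orbits, under the
   symmetries of the square, of (n, s, t, z) = (1, S, S, 2 lambda2 S^2) and
   (1, S, S, 2 S^2).  The update maps the cone of parameter S <= 1/2 into the
   one of parameter S / (1 + lambda2 S^4), and the messages of the leaves lie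
   in the cone of parameter 1/2.  Hence all messages become constant far from
   the boundary, uniformly in the boundary condition, and every single-site
   marginal of a Gibbs measure is uniform.

   For lambda2 > 1/3 the equation M g^2 = c g has a solution with
   g(0) > g(2) > 0.  The tree-indexed Markov chain with transition
   probabilities M(k,l) g(l)^2 / (c g(k)) and root law proportional to g^2 is
   then a Gibbs measure; it is realised on [0, 1[ by nested intervals. *)

Import Defs.

Set Implicit Arguments.
Unset Strict Implicit.
Unset Printing Implicit Defensive.

Import Order.TTheory GRing.Theory Num.Theory.

Local Open Scope classical_set_scope.
Local Open Scope ring_scope.

(** * The invariant cone *)

Section Cone.
Variable R : realFieldType.
Implicit Types l w u n s t z : R.

(* In the coordinates (n, s / S, t / S, z / S^2), where the cone no longer
   depends on S. *)
Definition cone l (n s t z : R) : Prop :=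
  [/\ [/\ 0 <= n - s, 0 <= n + s, 0 <= n - t & 0 <= n + t],
      0 <= 2 * n - z - (1 + l) * (s - t), 0 <= 2 * n - z - (1 + l) * (t - s),
      0 <= 2 * n + z - (1 + l) * (s + t) & 0 <= 2 * n + z + (1 + l) * (s + t)].

(** Together with [cone_swap] this generates the symmetries of the square, so that only one facet of
    each of the two types has to be verified for products. *)
Lemma cone_flip l n s t z : cone l n s t z -> cone l n (- s) t (- z).
Proof. by case=> -[????] ????; split; first split; lra. Qed.

Lemma cone_swap l n s t z : cone l n s t z -> cone l n t s z.
Proof. by case=> -[????] ????; split; first split; lra. Qed.

(** Non-negativity of the linear form with coefficients p, q, r, v on the eight extreme rays (1, e,
    f, e f c), where e and f are signs and c is 2 l or 2. *)
Definition extreme_ge0 l (p q r v : R) : Prop := forall c, c = 2 * l \/ c = 2 ->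
  [/\ 0 <= p + q + r + v * c, 0 <= p + q - r - v * c,
      0 <= p - q - r + v * c & 0 <= p - q + r - v * c].

(* Each case writes the point as a combination of three extreme rays of the
   lower or upper hull, plus a multiple of a facet inequality. *)
Lemma cone_dual l n s t z p q r v : 0 <= l -> extreme_ge0 l p q r v ->
  cone l n s t z -> 0 <= p * n + q * s + r * t + v * z.
Proof.
move=> l0 V [] [a1 a2 a3 a4] b1 b2 b3 b4.
have [] := V (2 * l) (or_introl erefl) => c1 c2 c3 c4.
have [] := V 2 (or_intror erefl) => d1 d2 d3 d4.
(* For v >= 0 the form is smallest at the lowest z, and the two lower facets meet along s + t = 0.
   For v < 0 the upper facets matter, which meet along s = t. *)
have [v0|v0] := leP 0 v.
  have [st|st] := leP 0 (s + t).
    have h : 0 <= (s + t) * (p + q + r + v * (2 * l)) +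
       (n - t) * (p + q - r - v * 2) + (n - s) * (p - q + r - v * 2)
       + 2 * (v * (2 * n + z - (1 + l) * (s + t))).
      by rewrite !addr_ge0 ?mulr_ge0.
    lra.
  have h : 0 <= (- (s + t)) * (p - q - r + v * (2 * l)) +
     (n + s) * (p + q - r - v * 2) + (n + t) * (p - q + r - v * 2)
     + 2 * (v * (2 * n + z + (1 + l) * (s + t))).
    by rewrite !addr_ge0 ?mulr_ge0 // oppr_ge0 ltW.
  lra.
rewrite -oppr_gt0 in v0; move/ltW: v0 => v0.
have [st|st] := leP 0 (s - t).
  have h : 0 <= (s - t) * (p + q - r - v * (2 * l)) +
     (n + t) * (p + q + r + v * 2) + (n - s) * (p - q - r + v * 2)
     + 2 * ((- v) * (2 * n - z - (1 + l) * (s - t))).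
    by rewrite !addr_ge0 ?mulr_ge0.
  lra.
have h : 0 <= (- (s - t)) * (p - q + r - v * (2 * l)) +
   (n + s) * (p + q + r + v * 2) + (n - t) * (p - q - r + v * 2)
   + 2 * ((- v) * (2 * n - z - (1 + l) * (t - s))).
  by rewrite !addr_ge0 ?mulr_ge0 // oppr_ge0 ltW.
lra.
Qed.

(* Coordinates of M (m1 m2), with w = S^2; the t-coordinate is [prod_s] with
   the roles of s and t exchanged. *)
Definition prod_n w n1 s1 t1 z1 n2 s2 t2 z2 : R :=
  n1 * n2 + w * (s1 * s2 + t1 * t2) + w ^+ 2 * (z1 * z2).
Definition prod_s w n1 s1 t1 z1 n2 s2 t2 z2 : R :=
  (n1 * s2 + s1 * n2 + w * (t1 * z2 + z1 * t2)) / 2.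
Definition prod_z l n1 s1 t1 z1 n2 s2 t2 z2 : R :=
  l * (n1 * z2 + z1 * n2 + s1 * t2 + t1 * s2).

(* Here u is the ratio of the new parameter S' to S. *)
Lemma cone_product_s l w u n1 s1 t1 z1 n2 s2 t2 z2 :
   0 < l -> 3 * l <= 1 -> 0 <= w -> 4 * w <= 1 ->
   u <= 1 -> 1 <= u * (1 + l * w ^+ 2) ->
   cone l n1 s1 t1 z1 -> cone l n2 s2 t2 z2 ->
  0 <= u * prod_n w n1 s1 t1 z1 n2 s2 t2 z2 - prod_s w n1 s1 t1 z1 n2 s2 t2 z2.
Proof.
move=> l0 l3 w0 w4 u1 ul c1 c2; rewrite /prod_n /prod_s.
have w20 : 0 <= w ^+ 2 by rewrite sqr_ge0.
have lw0 : 0 <= l * w ^+ 2 by rewrite mulr_ge0 // ltW.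
have u0 : 0 <= u by rewrite leNgt; apply/negP => hu; nra.
have lw3 : 3 * (l * w) <= w by nra.
have uw' : u * w <= w by nra.
have -> : u * (n1 * n2 + w * (s1 * s2 + t1 * t2) + w ^+ 2 * (z1 * z2)) -
   (n1 * s2 + s1 * n2 + w * (t1 * z2 + z1 * t2)) / 2 =
   (u * n2 - s2 / 2) * n1 + (u * w * s2 - n2 / 2) * s1
   + (u * w * t2 - w * z2 / 2) * t1 + (u * w ^+ 2 * z2 - w * t2 / 2) * z1.
  by field.
(* By bilinearity the duality applies to the first message and then to the second, which leaves one
   polynomial inequality in l, w, u for each pair of extreme rays. *)
apply: (cone_dual (ltW l0)) c1 => c hc.
have h e1 f1 : e1 ^+ 2 = 1 -> f1 ^+ 2 = 1 ->
   0 <= (u * n2 - s2 / 2) + e1 * (u * w * s2 - n2 / 2)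
   + f1 * (u * w * t2 - w * z2 / 2) + e1 * f1 * c * (u * w ^+ 2 * z2 - w * t2 / 2).
  move=> he hf.
  have -> : (u * n2 - s2 / 2) + e1 * (u * w * s2 - n2 / 2)
   + f1 * (u * w * t2 - w * z2 / 2) + e1 * f1 * c * (u * w ^+ 2 * z2 - w * t2 / 2)
    = (u - e1 / 2) * n2 + (e1 * u * w - 2^-1) * s2 + (f1 * u * w - e1 * f1 * c * w / 2) * t2
    + (e1 * f1 * c * u * w ^+ 2 - f1 * w / 2) * z2.
    by field.
  apply: (cone_dual (ltW l0)) c2 => d hd.
  have {}he : e1 = 1 \/ e1 = -1 by move/eqP: he; rewrite sqrf_eq1 => /orP[]/eqP; auto.
  have {}hf : f1 = 1 \/ f1 = -1 by move/eqP: hf; rewrite sqrf_eq1 => /orP[]/eqP; auto.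
  by case: he => ->; case: hf => ->; case: hc => ->; case: hd => ->; split; nra.
split; [have := h 1 1 | have := h 1 (-1) | have := h (-1) (-1) | have := h (-1) 1];
  rewrite ?sqrrN !expr1n => /(_ erefl erefl); clear; lra.
Qed.

(** Again a check on pairs of extreme rays. The powers of u arise because the facet inequality for
    the image is multiplied by u^2. *)
Lemma cone_product_z l w u n1 s1 t1 z1 n2 s2 t2 z2 :
   0 < l -> 3 * l <= 1 -> 0 <= w -> 4 * w <= 1 ->
   u <= 1 -> 1 <= u * (1 + l * w ^+ 2) ->
   cone l n1 s1 t1 z1 -> cone l n2 s2 t2 z2 ->
  0 <= 2 * u ^+ 2 * prod_n w n1 s1 t1 z1 n2 s2 t2 z2 - prod_z l n1 s1 t1 z1 n2 s2 t2 z2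
   - (1 + l) * u * (prod_s w n1 s1 t1 z1 n2 s2 t2 z2 - prod_s w n1 t1 s1 z1 n2 t2 s2 z2).
Proof.
move=> l0 l3 w0 w4 u1 ul c1 c2; rewrite /prod_n /prod_z /prod_s.
have w20 : 0 <= w ^+ 2 by rewrite sqr_ge0.
have lw0 : 0 <= l * w ^+ 2 by rewrite mulr_ge0 // ltW.
(* From w <= 1/4 and l <= 1/3 follows l w^2 <= 1/48, hence u >= 48/49. These bounds feed the calls
   of [nra] at the end. *)
have lw : 48 * (l * w ^+ 2) <= 1.
  have w2 : 16 * w ^+ 2 <= 1 by nra.
  nra.
have u0 : 0 <= u by rewrite leNgt; apply/negP => hu; nra.
have u9 : 48 <= 49 * u by nra.
have uu : 9 <= 10 * u ^+ 2 by nra.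
have lw1 : 0 <= l * w by rewrite mulr_ge0 // ltW.
have lw3 : 3 * (l * w) <= w by nra.
have uw : 48 * w <= 49 * (u * w) by nra.
have uw' : u * w <= w by nra.
clear lw0 lw u9.
set k := (1 + l) * u / 2.
set X := (X in 0 <= X).
have -> : X =
   (2 * u ^+ 2 * n2 - l * z2 - k * (s2 - t2)) * n1
   + (2 * u ^+ 2 * (w * s2) - l * t2 - k * (n2 - w * z2)) * s1
   + (2 * u ^+ 2 * (w * t2) - l * s2 - k * (- n2 + w * z2)) * t1
   + (2 * u ^+ 2 * (w ^+ 2 * z2) - l * n2 - k * (w * t2 - w * s2)) * z1.
  by rewrite /X /k; field.
apply: (cone_dual (ltW l0)) c1 => c hc.
have h e1 f1 : e1 ^+ 2 = 1 -> f1 ^+ 2 = 1 ->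
   0 <=    (2 * u ^+ 2 * n2 - l * z2 - k * (s2 - t2))
   + (2 * u ^+ 2 * (w * s2) - l * t2 - k * (n2 - w * z2)) * e1
   + (2 * u ^+ 2 * (w * t2) - l * s2 - k * (- n2 + w * z2)) * f1
   + (2 * u ^+ 2 * (w ^+ 2 * z2) - l * n2 - k * (w * t2 - w * s2)) * (e1 * f1 * c).
  move=> he hf.
  set Y := (X in 0 <= X).
  have -> : Y = (2 * u ^+ 2 - k * e1 + k * f1 - l * (e1 * f1 * c)) * n2
    + (- k + 2 * u ^+ 2 * w * e1 - l * f1 + k * w * (e1 * f1 * c)) * s2
    + (k - l * e1 + 2 * u ^+ 2 * w * f1 - k * w * (e1 * f1 * c)) * t2
    + (- l + k * w * e1 - k * w * f1 + 2 * u ^+ 2 * w ^+ 2 * (e1 * f1 * c)) * z2.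
    by rewrite /Y; ring.
  apply: (cone_dual (ltW l0)) c2 => d hd.
  have {}he : e1 = 1 \/ e1 = -1 by move/eqP: he; rewrite sqrf_eq1 => /orP[]/eqP; auto.
  have {}hf : f1 = 1 \/ f1 = -1 by move/eqP: hf; rewrite sqrf_eq1 => /orP[]/eqP; auto.
  rewrite /k; clear X k Y.
  by case: he => ->; case: hf => ->; case: hc => ->; case: hd => ->; split; nra.
split; [have := h 1 1 | have := h 1 (-1) | have := h (-1) (-1) | have := h (-1) 1];
  rewrite ?sqrrN !expr1n => /(_ erefl erefl); clear; lra.
Qed.

(** The eight facets are two known inequalities transported by flips and swaps, under which the
    product is equivariant. The image is multiplied by u^2 to avoid division. *)
Lemma cone_product_normalized l w u n1 s1 t1 z1 n2 s2 t2 z2 :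
   0 < l -> 3 * l <= 1 -> 0 <= w -> 4 * w <= 1 ->
   u <= 1 -> 1 <= u * (1 + l * w ^+ 2) ->
   cone l n1 s1 t1 z1 -> cone l n2 s2 t2 z2 ->
   cone l (u ^+ 2 * prod_n w n1 s1 t1 z1 n2 s2 t2 z2)
     (u * prod_s w n1 s1 t1 z1 n2 s2 t2 z2) (u * prod_s w n1 t1 s1 z1 n2 t2 s2 z2)
     (prod_z l n1 s1 t1 z1 n2 s2 t2 z2).
Proof.
move=> l0 l3 w0 w4 u1 ul c1 c2.
have u0 : 0 < u.
  rewrite ltNge; apply/negP => hu.
  have : 0 <= l * w ^+ 2 by rewrite mulr_ge0 ?sqr_ge0 ?ltW.
  nra.
have f1 a1 b1 d1 e1 a2 b2 d2 e2 (p : cone l a1 b1 d1 e1) (q : cone l a2 b2 d2 e2) :=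
  mulr_ge0 (ltW u0) (cone_product_s l0 l3 w0 w4 u1 ul p q).
have f2 a1 b1 d1 e1 a2 b2 d2 e2 (p : cone l a1 b1 d1 e1) (q : cone l a2 b2 d2 e2) :=
  cone_product_z l0 l3 w0 w4 u1 ul p q.
split; first split.
- by move: (f1 _ _ _ _ _ _ _ _ c1 c2); rewrite /prod_n /prod_s /prod_z; lra.
- by move: (f1 _ _ _ _ _ _ _ _ (cone_flip c1) (cone_flip c2)); rewrite /prod_n /prod_s /prod_z; lra.
- by move: (f1 _ _ _ _ _ _ _ _ (cone_swap c1) (cone_swap c2)); rewrite /prod_n /prod_s /prod_z; lra.
- by move: (f1 _ _ _ _ _ _ _ _ (cone_flip (cone_swap c1)) (cone_flip (cone_swap c2))); rewrite /prod_n /prod_s /prod_z; lra.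
- by move: (f2 _ _ _ _ _ _ _ _ c1 c2); rewrite /prod_n /prod_s /prod_z; lra.
- by move: (f2 _ _ _ _ _ _ _ _ (cone_swap c1) (cone_swap c2)); rewrite /prod_n /prod_s /prod_z; lra.
- by move: (f2 _ _ _ _ _ _ _ _ (cone_swap (cone_flip (cone_swap c1))) (cone_swap (cone_flip (cone_swap c2)))); rewrite /prod_n /prod_s /prod_z; lra.
- by move: (f2 _ _ _ _ _ _ _ _ (cone_flip c1) (cone_flip c2)); rewrite /prod_n /prod_s /prod_z; lra.
Qed.

Lemma cone_scale l c n s t z : 0 < c -> cone l (c * n) (c * s) (c * t) (c * z) <->
  cone l n s t z.
Proof.
move=> c0; split=> -[[a1 a2 a3 a4] a5 a6 a7 a8]; last first.
  have h x : 0 <= x -> 0 <= c * x by move=> x0; rewrite pmulr_rge0.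
  split; first split.
  - by move: (h _ a1); lra.
  - by move: (h _ a2); lra.
  - by move: (h _ a3); lra.
  - by move: (h _ a4); lra.
  - by move: (h _ a5); lra.
  - by move: (h _ a6); lra.
  - by move: (h _ a7); lra.
  - by move: (h _ a8); lra.
by split; first split; rewrite -(pmulr_rge0 _ c0); lra.
Qed.

(** Return to unnormalized coordinates, with w = S^2 and u = S' / S. Membership in the cone of
    parameter S is written after multiplication by S^2, so that no quotient appears. *)
Lemma cone_product l S S' n1 s1 t1 z1 n2 s2 t2 z2 :
   0 < l -> 3 * l <= 1 -> 0 < S -> 2 * S <= 1 -> S' <= S -> S <= S' * (1 + l * S ^+ 4) ->
   cone l (S ^+ 2 * n1) (S * s1) (S * t1) z1 ->
   cone l (S ^+ 2 * n2) (S * s2) (S * t2) z2 ->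
   cone l (S' ^+ 2 * (n1 * n2 + s1 * s2 + t1 * t2 + z1 * z2))
     (S' * ((n1 * s2 + s1 * n2 + t1 * z2 + z1 * t2) / 2))
     (S' * ((n1 * t2 + t1 * n2 + s1 * z2 + z1 * s2) / 2))
     (l * (n1 * z2 + z1 * n2 + s1 * t2 + t1 * s2)).
Proof.
move=> l0 l3 S0 S2 S'S SS' c1 c2.
have S20 : 0 < S ^+ 2 by rewrite exprn_gt0.
have Sn0 : S != 0 by rewrite gt_eqF.
have norm n s t z : cone l (S ^+ 2 * n) (S * s) (S * t) z ->
    cone l n (s / S) (t / S) (z / S ^+ 2).
  move=> c; apply/(cone_scale _ _ _ _ _ S20).
  suff -> : S ^+ 2 * (s / S) = S * s; first suff -> : S ^+ 2 * (t / S) = S * t; first suff -> : S ^+ 2 * (z / S ^+ 2) = z; by [|field].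
have p1 : 4 * S ^+ 2 <= 1.
  have : 0 <= (1 - 2 * S) * (1 + 2 * S) by apply: mulr_ge0; lra.
  lra.
have p2 : S' / S <= 1 by rewrite ler_pdivrMr // mul1r.
have p3 : 1 <= S' / S * (1 + l * (S ^+ 2) ^+ 2).
  by rewrite mulrAC ler_pdivlMr // mul1r -exprM.
have h := cone_product_normalized l0 l3 (ltW S20) p1 p2 p3 (norm _ _ _ _ c1) (norm _ _ _ _ c2).
move: (proj2 (cone_scale _ _ _ _ _ S20) h).
rewrite /prod_n /prod_s /prod_z.
set a := (X in cone _ X _ _ _); set b := (X in cone _ _ X _ _); set c := (X in cone _ _ _ X _); set d := (X in cone _ _ _ _ X).
have -> : a = (S' ^+ 2 * (n1 * n2 + s1 * s2 + t1 * t2 + z1 * z2)) by rewrite /a; field.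
have -> : b = (S' * ((n1 * s2 + s1 * n2 + t1 * z2 + z1 * t2) / 2)) by rewrite /b; field.
have -> : c = (S' * ((n1 * t2 + t1 * n2 + s1 * z2 + z1 * s2) / 2)) by rewrite /c; field.
have -> : d = (l * (n1 * z2 + z1 * n2 + s1 * t2 + t1 * s2)) by rewrite /d; field.
by [].
Qed.

End Cone.

(** * Cutsets and their interiors *)

(** Membership in the component of the root in terms of prefixes only, which avoids walks that
    backtrack. *)
Definition clear_of (C : {fset vertex}) (x : vertex) : Prop :=
  forall y, prefix y x -> y \notin C.

Lemma prefix_rcons_inv (x y : vertex) b :
  prefix y (rcons x b) -> prefix y x \/ y = rcons x b.
Proof.
case/prefixP => s; case/lastP: s => [|s c]; first by rewrite cats0; right.
by rewrite -rcons_cat => /eqP; rewrite eqseq_rcons => /andP[/eqP-> _]; left; rewrite prefix_prefix.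
Qed.

Lemma clear_of_rcons C x b : clear_of C (rcons x b) <-> clear_of C x /\ rcons x b \notin C.
Proof.
split=> [h|[h1 h2] y /prefix_rcons_inv[/h1//|->//]].
split=> [y yx|]; last exact: (h _ (prefix_refl _)).
exact: (h _ (prefix_trans yx (prefix_rcons _ _))).
Qed.

Lemma childP x y : reflect (exists b, y = rcons x b) (child x y).
Proof. by apply: (iffP existsP) => -[b]; [move/eqP|move->]; exists b. Qed.

Lemma clear_of_adj C x y : clear_of C x -> adj x y -> y \notin C -> clear_of C y.
Proof.
move=> h /orP[/childP[b ->] yC|/childP[b xE] _]; first by apply/clear_of_rcons.
by move: h; rewrite xE => /clear_of_rcons[].
Qed.

(** A walk avoiding C keeps its endpoint clear: a step to a child adds one vertex outside C to the
    prefixes, a step to the parent removes one. Conversely the prefixes of x form a walk. *)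
Lemma clear_of_path C x : (exists p : seq vertex,
    [/\ path adj origin p, last origin p = x & all (predC (mem C)) (origin :: p)])
  <-> clear_of C x.
Proof.
split=> [[p [+ + /= /andP[oC]]]|].
  have : clear_of C origin by move=> y; rewrite prefixs0 => /eqP->.
  elim: p origin {oC} => [|y p IH] z cz /=; first by move=> _ <-.
  move=> /andP[zy yp] l /andP[yC pC]; apply: (IH y) => //.
  exact: clear_of_adj zy _.
elim/last_ind: x => [|x b IH] cx.
  by exists [::]; split=> //=; rewrite andbT; apply: cx.
have [cx1 xbC] := proj1 (clear_of_rcons _ _ _) cx.
have [p [pp pl pC]] := IH cx1; exists (rcons p (rcons x b)); split.
- by rewrite rcons_path pp pl /adj /=; apply/orP; left; apply/childP; exists b.
- by rewrite last_rcons.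
- by rewrite -rcons_cons all_rcons pC andbT.
Qed.

Definition ray_through (x : vertex) (i : nat) : vertex :=
  take i x ++ nseq (i - size x) false.

Lemma size_ray_through x i : size (ray_through x i) = i.
Proof.
rewrite size_cat size_nseq size_take; case: ltnP => h.
  by rewrite (eqP (ltnW h)) addn0.
by rewrite subnKC.
Qed.

Lemma ray_throughP x : ray (ray_through x).
Proof.
split.
- by apply/nilP; rewrite /nilp size_ray_through.
- by move=> i j /(congr1 size); rewrite !size_ray_through.
move=> i; apply/orP; left; apply/childP; rewrite /ray_through.
case: (ltnP i (size x)) => h.
  exists (nth false x i); rewrite (eqP h) (eqP (ltnW h)) !cats0.
  by rewrite -take_nth.
exists false; rewrite !take_oversize ?(leqW h) // subSn // rcons_cat; congr (_ ++ _).
by rewrite -cats1 -addn1 nseqD.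
Qed.

(** The ray through x meets C. If x is clear it does so below x, so x is no deeper than the deepest
    vertex of C. *)
Lemma clear_of_bounded C : cutset C -> exists n, forall x, clear_of C x -> (size x < n)%N.
Proof.
move=> [hray _]; pose n := (\max_(y <- C) size y)%N; exists n.+1 => x cx.
rewrite ltnS leqNgt; apply/negP => hn.
have [i] := hray _ (ray_throughP x).
case: (leqP i (size x)) => h.
  apply/negP; apply: cx; rewrite /ray_through (eqP h) cats0.
  by apply/prefixP; exists (drop i x); rewrite cat_take_drop.
move=> iC; have : (size (ray_through x i) <= n)%N.
  exact: (@leq_bigmax_seq _ _ predT (fun y : vertex => size y)).
by rewrite size_ray_through leqNgt (ltn_trans hn h).
Qed.

Fixpoint ball n : seq vertex :=
  if n is n'.+1 then [::] :: map (cons false) (ball n') ++ map (cons true) (ball n')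
  else [::].

Lemma mem_ball n x : (x \in ball n) = (size x < n)%N.
Proof.
elim: n x => [//|n IH] [|b x] /=; first by rewrite inE.
rewrite inE /= mem_cat ltnS -IH; case: b.
  rewrite mem_map; last by move=> ? ? [].
  by case: mapP => // -[? _ []].
rewrite mem_map; last by move=> ? ? [].
by case: (boolP (x \in _)) => // _; case: mapP => // -[? _ []].
Qed.

Lemma uniq_ball n : uniq (ball n).
Proof.
elim: n => [//|n IH] /=; rewrite mem_cat cat_uniq !map_inj_uniq ?IH; try by move=> ? ? [].
rewrite andbT /=; apply/andP; split.
  by apply/negP => /orP[] /mapP[].
by apply/hasPn => x /mapP[y _ ->]; apply/negP => /mapP[].
Qed.

(** [fset_set] is faithful only on finite sets; finiteness comes from [clear_of_bounded]. *)
Lemma mem_interior C x : cutset C -> (x \in interior C) <-> clear_of C x.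
Proof.
move=> cC; rewrite /interior in_fset_set; last first.
  have [n hn] := clear_of_bounded cC.
  apply: (@sub_finite_set _ _ [set` ball n]); last exact: finite_seq.
  by move=> y /= /clear_of_path/hn; rewrite mem_ball.
by rewrite inE; exact: clear_of_path.
Qed.

Lemma interior_rcons C x b : cutset C -> x \in interior C ->
  (rcons x b \in interior C) = (rcons x b \notin C).
Proof.
move=> cC /(mem_interior x cC) cx; apply/idP/idP.
  by move/(mem_interior _ cC)/clear_of_rcons => -[].
by move=> h; apply/(mem_interior _ cC)/clear_of_rcons.
Qed.

Lemma interior_prefix C x y : cutset C -> prefix y x -> x \in interior C -> y \in interior C.
Proof.
move=> cC yx /(mem_interior _ cC) cx; apply/(mem_interior _ cC) => z zy.
exact/cx/(prefix_trans zy).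
Qed.

Lemma interior_notin C x : cutset C -> x \in interior C -> x \notin C.
Proof. by move=> cC /(mem_interior _ cC); apply; rewrite prefix_refl. Qed.

Definition sphere n : {fset vertex} := [fset x in ball n.+1 | size x == n]%fset.

Lemma mem_sphere n x : (x \in sphere n) = (size x == n).
Proof.
have := mem_ball n.+1 x; rewrite /sphere; move: (ball _) => B xB.
by rewrite !inE /= xB; case: eqP => [->|_]; rewrite ?andbT ?andbF // ltnSn.
Qed.

Lemma adj_size x y : adj x y -> size y = (size x).+1 \/ size x = (size y).+1.
Proof. by case/orP => /childP[b ->]; rewrite size_rcons; auto. Qed.

(** Along a ray the depth changes by one at each step, so a ray avoiding the sphere would stay in a
    finite ball, against its injectivity. *)
Lemma cutset_sphere n : cutset (sphere n).
Proof.
split; last by move=> [x [y []]]; rewrite !mem_sphere => /eqP-> /eqP->; rewrite ltnn.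
move=> p [p0 pi pa]; apply: contrapT => hC.
have hn i : p i \notin sphere n by apply/negP => h; apply: hC; exists i.
have hs i : (size (p i) < n)%N.
  elim: i => [|i IH].
    by rewrite p0 lt0n; apply: contra (hn 0%N); rewrite p0 mem_sphere eq_sym.
  have := hn i.+1; rewrite mem_sphere => hi.
  case: (adj_size (pa i)) => h; last by rewrite h in IH; exact: ltnW.
  by rewrite ltn_neqAle hi h.
have /uniq_leq_size : uniq (map p (iota 0 (size (ball n)).+1)).
  by rewrite map_inj_uniq ?iota_uniq.
move=> /(_ (ball n)); rewrite size_map size_iota ltnn => /(_ _)/notF; apply.
by move=> _ /mapP[i _ ->]; rewrite mem_ball.
Qed.

Definition glue (C : {fset vertex}) (omega : {ffun interior C -> spin})
    (delta : configuration) : configuration :=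
  fun x => if insub x is Some y then omega y else delta x.

Section Glue.
Variables (C : {fset vertex}) (omega : {ffun interior C -> spin}) (delta : configuration).

Lemma glue_val (x : interior C) : glue omega delta (val x) = omega x.
Proof. by rewrite /glue valK. Qed.

Lemma glue_out x : x \notin interior C -> glue omega delta x = delta x.
Proof. by move=> h; rewrite /glue insubN. Qed.

End Glue.

Lemma sum_children (V : nmodType) (A : {fset vertex}) x (F : vertex -> V) :
  \sum_(y : A | child x (val y)) F (val y) =
  \sum_(b : bool | rcons x b \in A) F (rcons x b).
Proof.
rewrite -(big_seq_fsetE _ A (child x) F) /= -big_filter.
rewrite -[RHS]big_filter -(big_map (rcons x) xpredT).
apply: perm_big; apply: uniq_perm.
- by rewrite filter_uniq // fset_uniq.
- by rewrite map_inj_uniq ?filter_uniq ?index_enum_uniq //; exact: rcons_injr.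
move=> y; rewrite mem_filter; apply/andP/mapP => [[/childP[b ->] yA]|[b + ->]].
  by exists b => //; rewrite mem_filter yA mem_index_enum.
by rewrite mem_filter => /andP[? _]; split=> //; apply/childP; exists b.
Qed.

Section Energy.
Context {R : realType}.
Variables (lambda1 lambda2 : R).
Hypothesis M0 : forall i j, 0 < M lambda1 lambda2 i j.

(** The parent of an interior vertex is interior, so the edges to C lead to children, and every
    child of an interior vertex is interior or in C. The two double sums thus merge into one over
    all children. *)
Lemma energyE (C : {fset vertex}) (delta : configuration) omega : cutset C ->
  energy lambda1 lambda2 delta omega = \sum_(x : interior C) \sum_(b : bool)
    Phi lambda1 lambda2 (omega x) (glue omega delta (rcons (val x) b)).
Proof.
move=> cC; rewrite /energy -big_split /=; apply: eq_bigr => x _.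
rewrite [RHS](bigID (fun b => rcons (val x) b \in interior C)) /=; congr (_ + _).
  rewrite -(sum_children (interior C) (val x) (fun y => Phi lambda1 lambda2 (omega x) (glue omega delta y))).
  by apply: eq_bigr => y _; rewrite glue_val.
under [RHS]eq_bigl => b do rewrite interior_rcons ?(valP x) // negbK.
transitivity (\sum_(b | rcons (val x) b \in C) Phi lambda1 lambda2 (omega x) (delta (rcons (val x) b))).
  rewrite -(sum_children C (val x) (fun y => Phi lambda1 lambda2 (omega x) (delta y))).
  apply: eq_bigl => y; apply/orP/idP => [[//|]|]; last by left.
  case/childP => b xE; have h := fsvalP x; rewrite xE in h.
  have := interior_notin cC (interior_prefix cC (prefix_rcons (val y) b) h).
  by rewrite (valP y).
apply: eq_bigr => b xb; rewrite glue_out // interior_rcons ?(valP x) // negbK //.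
Qed.

Lemma expR_energy (C : {fset vertex}) (delta : configuration) omega : cutset C ->
  expR (- energy lambda1 lambda2 delta omega) = \prod_(x : interior C) \prod_(b : bool)
    M lambda1 lambda2 (omega x) (glue omega delta (rcons (val x) b)).
Proof.
move=> cC; rewrite energyE // -sumrN expR_sum; apply: eq_bigr => x _.
by rewrite -sumrN expR_sum; apply: eq_bigr => b _; rewrite /Phi opprK lnK // posrE.
Qed.

Lemma partition_function_gt0 (C : {fset vertex}) (delta : configuration) :
  0 < partition_function lambda1 lambda2 C delta.
Proof.
rewrite /partition_function (bigD1 [ffun=> ord0]) //= ltr_pwDl ?expR_gt0 //.
by apply: sumr_ge0 => *; exact: expR_ge0.
Qed.

End Energy.

(** * Sums over the configurations of a ball *)

Definition shift {A : Type} (b : bool) (f : vertex -> A) : vertex -> A :=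
  fun w => f (b :: w).

(* Configurations of the ball of radius n, as labelled binary trees. *)
Fixpoint conf (n : nat) : finType :=
  if n is n'.+1 then (spin * (conf n' * conf n'))%type else unit.

Fixpoint lookup (n : nat) : conf n -> configuration -> configuration :=
  match n with
  | 0%N => fun _ delta => delta
  | n'.+1 => fun c delta v =>
      if v is b :: w then lookup (if b then c.2.1 else c.2.2) (shift b delta) w
      else c.1
  end.

Fixpoint conf_of (n : nat) (sigma : configuration) : conf n :=
  match n with
  | 0%N => tt
  | n'.+1 => (sigma [::], (conf_of n' (shift true sigma), conf_of n' (shift false sigma)))
  end.

Lemma lookup_conf_of n sigma delta v : (size v < n)%N -> lookup (conf_of n sigma) delta v = sigma v.
Proof.
by elim: n sigma delta v => [//|n IH] sigma delta [//|b w] /=; case: b => ?; rewrite IH.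
Qed.

Lemma lookup_out n (c : conf n) delta v : (n <= size v)%N -> lookup c delta v = delta v.
Proof.
by elim: n c delta v => [//|n IH] c delta [//|b w] /= ?; rewrite IH.
Qed.

Lemma conf_of_lookup n (c : conf n) delta : conf_of n (lookup c delta) = c.
Proof.
elim: n c delta => [[]//|n IH] [k [c1 c0]] delta /=; congr (_, (_, _)); exact: IH.
Qed.

Lemma mem_interior_sphere n x : (x \in interior (sphere n)) = (size x < n)%N.
Proof.
apply/idP/idP => [/(mem_interior _ (cutset_sphere n)) cx|xn].
  rewrite ltnNge; apply/negP => nx.
  have := cx _ (prefix_take x n); rewrite mem_sphere size_take.
  by case: ltngtP nx => // <-; rewrite eqxx.
apply/(mem_interior _ (cutset_sphere n)) => y /size_prefix yx.
by rewrite mem_sphere; apply/eqP => yn; move: xn; rewrite -yn ltnNge yx.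
Qed.

(** Replaces functions on the interior of a sphere by labelled trees, on which sums can be computed
    by recursion on the depth. *)
Lemma sum_glue (V : nmodType) n delta (F : configuration -> V) :
  \sum_(omega : {ffun interior (sphere n) -> spin}) F (glue omega delta) =
  \sum_(c : conf n) F (lookup c delta).
Proof.
pose h (c : conf n) : {ffun interior (sphere n) -> spin} := [ffun x => lookup c delta (val x)].
have glue_h c : glue (h c) delta = lookup c delta.
  apply/funext => v; case: (boolP (v \in interior (sphere n))) => vi.
    by rewrite -[v]/(val [` vi]%fset) glue_val ffunE.
  by rewrite glue_out // lookup_out // leqNgt -mem_interior_sphere.
rewrite (reindex h) /=; first by apply: eq_bigr => c _; rewrite glue_h.
exists (fun omega => conf_of n (glue omega delta)) => [c _|omega _].
  by rewrite glue_h conf_of_lookup.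
apply/ffunP => x; rewrite ffunE lookup_conf_of ?glue_val //.
by rewrite -mem_interior_sphere (valP x).
Qed.

Section TreeSum.
Context {R : realType}.
Variable K : spin -> spin -> R.
Implicit Types (phi : vertex -> spin -> R) (delta sigma : configuration).

(** With phi = 1 this is the Boltzmann weight of the ball; with phi a [site_indicator] it is
    restricted to one value at one site. *)
Definition tree_weight n phi sigma : R :=
  \prod_(x <- ball n) (phi x (sigma x) * \prod_(b : bool) K (sigma x) (sigma (rcons x b))).

(* The message sent to a parent of spin k by a subtree of depth n with
   boundary condition delta and site weights phi. *)
Fixpoint message n phi delta (k : spin) : R :=
  if n is n'.+1 then
    \sum_(l : spin) K k l * (phi [::] l * \prod_(b : bool) message n' (shift b phi) (shift b delta) l)
  else K k (delta [::]).

Lemma tree_weightS n phi sigma : tree_weight n.+1 phi sigma =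
  phi [::] (sigma [::]) * \prod_(b : bool)
    (K (sigma [::]) (sigma [:: b]) * tree_weight n (shift b phi) (shift b sigma)).
Proof.
rewrite /tree_weight /= big_cons -mulrA; congr (_ * _).
rewrite [RHS]big_split /=; congr (_ * _).
rewrite big_cat !big_map [RHS]big_bool /= mulrC; congr (_ * _).
Qed.

Lemma sum_conf n delta (F : spin -> configuration -> configuration -> R) :
  \sum_(c : conf n.+1) F (lookup c delta [::]) (shift true (lookup c delta)) (shift false (lookup c delta)) =
  \sum_(l : spin) \sum_(c1 : conf n) \sum_(c0 : conf n) F l (lookup c1 (shift true delta)) (lookup c0 (shift false delta)).
Proof.
rewrite pair_big /= pair_big /=.
rewrite (reindex (fun p : spin * conf n * conf n => (p.1.1, (p.1.2, p.2)))) /=; last first.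
  by exists (fun p => ((p.1, p.2.1), p.2.2)) => [[[? ?] ?] _|[? [? ?]] _].
by apply: eq_bigr => -[[l c1] c0] _ /=; rewrite /shift /=.
Qed.

(** The root factor G is kept free: G = K k gives the recursion of messages, G = 1 the total weight
    of a ball. The hypothesis is the induction hypothesis of [sum_tree_weight]. *)
Lemma sum_tree_weightS n phi delta (G : spin -> R) :
  (forall b k, \sum_(c : conf n) K k (lookup c (shift b delta) [::]) * tree_weight n (shift b phi) (lookup c (shift b delta))
     = message n (shift b phi) (shift b delta) k) ->
  \sum_(c : conf n.+1) G (lookup c delta [::]) * tree_weight n.+1 phi (lookup c delta) =
  \sum_(l : spin) G l * (phi [::] l * \prod_(b : bool) message n (shift b phi) (shift b delta) l).
Proof.
move=> IH.
pose F l s1 s0 := G l * (phi [::] l * ((K l (s1 [::]) * tree_weight n (shift true phi) s1)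
   * (K l (s0 [::]) * tree_weight n (shift false phi) s0))).
transitivity (\sum_(c : conf n.+1) F (lookup c delta [::]) (shift true (lookup c delta)) (shift false (lookup c delta))).
  by apply: eq_bigr => c _; rewrite tree_weightS big_bool.
rewrite sum_conf; apply: eq_bigr => l _; rewrite big_bool -!IH /= big_distrlr /= !mulr_sumr.
by apply: eq_bigr => c1 _; rewrite !mulr_sumr.
Qed.

Lemma sum_tree_weight n phi delta k :
  \sum_(c : conf n) K k (lookup c delta [::]) * tree_weight n phi (lookup c delta) = message n phi delta k.
Proof.
elim: n phi delta k => [|n IH] phi delta k /=.
  by rewrite /index_enum (big_pred1 tt) /=; [rewrite /tree_weight big_nil mulr1|case].
by rewrite (sum_tree_weightS (K k)) // => b l; exact: IH.
Qed.

Definition site_indicator (v : vertex) (k : spin) : vertex -> spin -> R :=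
  fun x l => if x == v then (l == k)%:R else 1.

(* Moving the root along the path to v absorbs the siblings into g, one update
   at a time. *)
Lemma message_path (P : (spin -> R) -> Prop) n v delta (g : spin -> R) :
  (forall k l, K k l = K l k) ->
  (forall f h, P f -> P h -> P (fun k => \sum_l K k l * (f l * h l))) ->
  (forall d eta, (n - size v <= d)%N -> P (message d (fun _ _ => 1) eta)) ->
  (size v <= n)%N -> P g ->
  exists g' m0 m1, [/\ P g', P m0, P m1 & forall k,
    \sum_l g l * (site_indicator v k [::] l * \prod_(b : bool) message n (shift b (site_indicator v k)) (shift b delta) l) =
    g' k * (m0 k * m1 k)].
Proof.
move=> Ksym PK; elim: v n delta g => [|b v IH] n delta g Pm vn Pg.
  exists g, (message n (fun _ _ => 1) (shift true delta)), (message n (fun _ _ => 1) (shift false delta)).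
  split=> //; try by apply: Pm; rewrite leq_subr.
  move=> k; have sh b : shift b (site_indicator [::] k) = fun _ _ => 1 by [].
  under eq_bigr => l _ do rewrite big_bool !sh.
  rewrite (bigD1 k) //= big1 ?addr0 => [|l lk]; rewrite /site_indicator eqxx.
    by rewrite eqxx mul1r.
  by rewrite (negPf lk) mul0r mulr0.
case: n vn Pm => [//|n]; rewrite ltnS => vn Pm.
(* The subtree hanging off the path to v sends an ordinary message, which is multiplied into g
   before the update. *)
pose m := message n.+1 (fun _ _ => 1) (shift (~~ b) delta).
have Pmm : P m by apply: Pm; rewrite leq_subr.
have [|g' [m0 [m1 [Pg' Pm0 Pm1 E]]]] := IH n (shift b delta) (fun k => \sum_l K k l * (g l * m l)) _ vn (PK _ _ Pg Pmm).
  by move=> d eta h; apply: Pm; rewrite subSS.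
exists g', m0, m1; split=> // k; rewrite -E.
have shb : shift b (site_indicator (b :: v) k) = site_indicator v k.
  by apply/funext => x; rewrite /shift /site_indicator eqseq_cons eqxx.
have shn : shift (~~ b) (site_indicator (b :: v) k) = fun _ _ => 1.
  by apply/funext => x; rewrite /shift /site_indicator eqseq_cons; case: (b).
transitivity (\sum_l g l * (m l * message n.+1 (site_indicator v k) (shift b delta) l)).
  apply: eq_bigr => l _; rewrite {1}/site_indicator /= mul1r; congr (_ * _).
  by rewrite big_bool; case: (b) shb shn @m {Pmm E} => /= -> -> //; rewrite mulrC.
(* After exchanging the sums, symmetry of K turns the edge towards v into an update of the function
   coming from the old root. *)
under eq_bigr => l _ do rewrite mulrA /= mulr_sumr.
rewrite exchange_big /=; apply: eq_bigr => l _; rewrite mulr_suml.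
by apply: eq_bigr => i _; rewrite Ksym; ring.
Qed.

End TreeSum.

(** * The clock model in Fourier coordinates *)

Definition k0 : spin := @Ordinal 4 0 isT.
Definition k1 : spin := @Ordinal 4 1 isT.
Definition k2 : spin := @Ordinal 4 2 isT.
Definition k3 : spin := @Ordinal 4 3 isT.

Lemma spin_ind (P : spin -> Prop) : P k0 -> P k1 -> P k2 -> P k3 -> forall k, P k.
Proof.
move=> p0 p1 p2 p3 [[|[|[|[|//]]]] i].
- by rewrite (_ : Ordinal i = k0) //; exact: val_inj.
- by rewrite (_ : Ordinal i = k1) //; exact: val_inj.
- by rewrite (_ : Ordinal i = k2) //; exact: val_inj.
- by rewrite (_ : Ordinal i = k3) //; exact: val_inj.
Qed.

Lemma sum_spin (V : zmodType) (f : spin -> V) : \sum_k f k = f k0 + f k1 + f k2 + f k3.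
Proof.
rewrite !big_ord_recl big_ord0 addr0 !addrA.
by congr (_ + _ + _ + _); congr f; exact: val_inj.
Qed.

Section Model.
Context {R : realType}.
Variable l : R.
Implicit Types (S : R) (f h : spin -> R).

Notation K := (M 2%:R^-1 l).

Lemma M_first_row k j : K k j = first_row 2%:R^-1 l (j - k).
Proof. by rewrite mxE. Qed.

Lemma M_sym k j : K k j = K j k.
Proof.
rewrite !M_first_row.
by elim/spin_ind: k; elim/spin_ind: j.
Qed.

Definition transfer f : spin -> R := fun k => \sum_j K k j * f j.

Lemma transferE f :
  [/\ transfer f k0 = (2 + l) / 4 * f k0 + (1 - l) / 4 * f k1 + l / 4 * f k2 + (1 - l) / 4 * f k3,
      transfer f k1 = (1 - l) / 4 * f k0 + (2 + l) / 4 * f k1 + (1 - l) / 4 * f k2 + l / 4 * f k3,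
      transfer f k2 = l / 4 * f k0 + (1 - l) / 4 * f k1 + (2 + l) / 4 * f k2 + (1 - l) / 4 * f k3
    & transfer f k3 = (1 - l) / 4 * f k0 + l / 4 * f k1 + (1 - l) / 4 * f k2 + (2 + l) / 4 * f k3].
Proof.
by split; rewrite /transfer sum_spin !M_first_row /first_row /=; field.
Qed.

(** The spins [k0], [k1], [k2], [k3] are the sign pairs (+,+), (+,-), (-,-), (-,+). The four sums
    are four times the coefficients n, s, t, z of f, and all coordinates carry the factor S^2. *)
Definition in_cone S f : Prop :=
  cone l (S ^+ 2 * (f k0 + f k1 + f k2 + f k3)) (S * (f k0 + f k1 - f k2 - f k3))
    (S * (f k0 - f k1 - f k2 + f k3)) (f k0 - f k1 + f k2 - f k3).

Lemma in_cone_transfer S S' f h :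
  0 < l -> 3 * l <= 1 -> 0 < S -> 2 * S <= 1 -> S' <= S -> S <= S' * (1 + l * S ^+ 4) ->
  in_cone S f -> in_cone S h -> in_cone S' (transfer (fun k => f k * h k)).
Proof.
move=> l0 l3 S0 S2 S'S SS' c1 c2.
have c := cone_product l0 l3 S0 S2 S'S SS' c1 c2.
(* Since the coordinates are four times the Fourier coefficients, those of a product acquire a
   factor 1/4. *)
have four : 0 < 4^-1 :> R by rewrite invr_gt0.
move: (proj2 (cone_scale _ _ _ _ _ four) c); rewrite /in_cone.
have [-> -> -> ->] := transferE (fun k => f k * h k).
set a := (X in cone _ X _ _ _ -> _); set b := (X in cone _ _ X _ _ -> _).
set d := (X in cone _ _ _ X _ -> _); set e := (X in cone _ _ _ _ X -> _).
set a' := (X in _ -> cone _ X _ _ _); set b' := (X in _ -> cone _ _ X _ _).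
set d' := (X in _ -> cone _ _ _ X _); set e' := (X in _ -> cone _ _ _ _ X).
have -> : a = a' by rewrite /a /a'; field.
have -> : b = b' by rewrite /b /b'; field.
have -> : d = d' by rewrite /d /d'; field.
have -> : e = e' by rewrite /e /e'; field.
by [].
Qed.

(** Up to symmetry a column of M has coordinates (1, 1/2, 1/2, l), which lies between the extreme
    rays with last coordinate l/2 and 1/2. *)
Lemma in_cone_M j : 0 < l -> 3 * l <= 1 -> in_cone 2^-1 (fun k => K k j).
Proof.
move=> l0 l3; rewrite /in_cone !M_first_row.
by elim/spin_ind: j; rewrite /first_row /=; split; try split; try lra; nra.
Qed.

Lemma in_cone1 S : in_cone S (fun=> 1).
Proof. by rewrite /in_cone; split; first split; nra. Qed.

(** Each 4 f(k) equals n plus or minus s, t and z. Here s and t are at most S n in absolute value,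
    and z at most 2 S^2 n <= S n. *)
Lemma in_cone_bounds S f : 0 < S -> 2 * S <= 1 -> 0 < l -> in_cone S f ->
  0 <= \sum_j f j /\ forall k,
  (1 - 3 * S) / 4 * (\sum_j f j) <= f k <= (1 + 3 * S) / 4 * (\sum_j f j).
Proof.
move=> S0 S2 l0 [[a1 a2 a3 a4] a5 a6 a7 a8]; rewrite sum_spin.
have n0 : 0 <= f k0 + f k1 + f k2 + f k3.
  by rewrite -(pmulr_rge0 _ (exprn_gt0 2 S0)); lra.
set n := f k0 + f k1 + f k2 + f k3 in n0 a1 a2 a3 a4 a5 a6 a7 a8 *.
have {}a1 : 0 <= S * n - (f k0 + f k1 - f k2 - f k3) by rewrite -(pmulr_rge0 _ S0); lra.
have {}a2 : 0 <= S * n + (f k0 + f k1 - f k2 - f k3) by rewrite -(pmulr_rge0 _ S0); lra.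
have {}a3 : 0 <= S * n - (f k0 - f k1 - f k2 + f k3) by rewrite -(pmulr_rge0 _ S0); lra.
have {}a4 : 0 <= S * n + (f k0 - f k1 - f k2 + f k3) by rewrite -(pmulr_rge0 _ S0); lra.
have Sn : 0 <= (1 - 2 * S) * (S * n) by rewrite !mulr_ge0 ?(ltW S0) //; lra.
have {a5 a6} zle : f k0 - f k1 + f k2 - f k3 <= S * n by lra.
have {a7 a8} zge : - (f k0 - f k1 + f k2 - f k3) <= S * n by lra.
have nE : n = f k0 + f k1 + f k2 + f k3 by [].
by split=> //; elim/spin_ind; apply/andP; split; lra.
Qed.

End Model.

(** * Uniform estimate for the finite-volume measures *)

Section Uniqueness.
Context {R : realType}.
Variable l : R.
Hypothesis l0 : 0 < l.
Hypothesis l3 : 3 * l <= 1.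
Hypothesis M0 : forall i j, 0 < M 2%:R^-1 l i j.
Let K : spin -> spin -> R := fun_of_matrix (M 2%:R^-1 l).

Fixpoint radius (d : nat) : R :=
  if d is d'.+1 then radius d' / (1 + l * radius d' ^+ 4) else 2^-1.

Lemma radius_gt0 d : 0 < radius d.
Proof.
elim: d => [|d IH] /=; first by rewrite invr_gt0.
by rewrite divr_gt0 // ltr_pwDl // mulr_ge0 ?exprn_ge0 ?ltW.
Qed.

Lemma radius_den d : 0 < 1 + l * radius d ^+ 4.
Proof. by rewrite ltr_pwDl // mulr_ge0 ?exprn_ge0 ?ltW // radius_gt0. Qed.

Lemma radiusS_le d : radius d.+1 <= radius d.
Proof.
rewrite /= ler_pdivrMr ?radius_den // ler_peMr ?(ltW (radius_gt0 _)) //.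
by rewrite lerDl mulr_ge0 ?exprn_ge0 ?ltW // radius_gt0.
Qed.

Lemma radius_le d : 2 * radius d <= 1.
Proof.
elim: d => [|d IH]; first by rewrite /= divff.
by apply: le_trans IH; rewrite ler_pM2l // radiusS_le.
Qed.

(** The inverse radius grows by l S^3 at each step. If all radii were at least eps it would grow
    linearly, while being bounded by 1 / eps. *)
Lemma radius_lim (eps : R) : 0 < eps -> exists d, radius d < eps.
Proof.
move=> e0; apply: contrapT => h.
have re d : eps <= radius d by rewrite leNgt; apply/negP => ?; apply: h; exists d.
have grow d : d%:R * (l * eps ^+ 3) <= (radius d)^-1.
  elim: d => [|d IH]; first by rewrite mul0r invr_ge0 ltW // radius_gt0.
  have rn0 : radius d != 0 by rewrite gt_eqF // radius_gt0.
  rewrite /= invf_div mulrDl mul1r -natr1 mulrDl mul1r lerD //.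
  have -> : l * radius d ^+ 4 / radius d = l * radius d ^+ 3 by field.
  by rewrite ler_pM2l // lerXn2r ?nnegrE ?(ltW e0) // ltW // radius_gt0.
have le0 : 0 < l * eps ^+ 3 by rewrite mulr_gt0 ?exprn_gt0.
have ei0 : 0 < eps^-1 by rewrite invr_gt0.
have := archi_boundP (ltW (divr_gt0 ei0 le0)).
rewrite ltr_pdivrMr // ltNge => /negP; apply.
by apply: le_trans (grow _) _; rewrite lef_pV2 // posrE radius_gt0.
Qed.

Lemma in_cone_message d e delta : (d <= e)%N ->
  in_cone l (radius d) (message K e (fun _ _ => 1) delta).
Proof.
have tr S S' f h : 0 < S -> 2 * S <= 1 -> S' <= S -> S <= S' * (1 + l * S ^+ 4) ->
   in_cone l S f -> in_cone l S h -> in_cone l S' (fun k => \sum_j K k j * (f j * h j)).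
  exact: in_cone_transfer.
have msgS n eta : message K n.+1 (fun _ _ => 1) eta = fun k => \sum_j K k j *
    (message K n (fun _ _ => 1) (shift true eta) j * message K n (fun _ _ => 1) (shift false eta) j).
  by apply/funext => k /=; apply: eq_bigr => j _; rewrite mul1r big_bool.
elim: d e delta => [|d IH] e delta.
  (* Parameter 1/2 holds for the leaves and is merely preserved. Each unit of d then spends one
     level on shrinking the cone. *)
  elim: e delta => [|e IH] delta _; first exact: in_cone_M.
  rewrite msgS; apply: (tr (radius 0)); rewrite ?radius_gt0 ?radius_le //; try exact: IH.
  by rewrite ler_peMr ?(ltW (radius_gt0 _)) // lerDl mulr_ge0 ?exprn_ge0 ?ltW // radius_gt0.
case: e => // e; rewrite ltnS => de.
rewrite msgS; apply: (tr (radius d)); rewrite ?radius_gt0 ?radius_le ?radiusS_le //; try exact: IH.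
by rewrite /= divfK // gt_eqF // radius_den.
Qed.

Lemma cone_closed d f h : in_cone l (radius d) f -> in_cone l (radius d) h ->
  in_cone l (radius d) (fun k => \sum_j K k j * (f j * h j)).
Proof.
apply: in_cone_transfer; rewrite ?radius_gt0 ?radius_le //.
by rewrite ler_peMr ?(ltW (radius_gt0 _)) // lerDl mulr_ge0 ?exprn_ge0 ?ltW // radius_gt0.
Qed.

(* The constant 30 comes from (1 - y)^3 >= 1 - 3y and (1 + y)^3 <= 1 + 7y at
   y = 3S. *)
Lemma in_cone_product S (f1 f2 f3 : spin -> R) (eps : R) : 0 < S -> 0 < eps -> 4 * S <= 1 -> 30 * S <= 4 * eps ->
  in_cone l S f1 -> in_cone l S f2 -> in_cone l S f3 -> forall k,
  (4^-1 - eps) * (\sum_j f1 j * (f2 j * f3 j)) <= f1 k * (f2 k * f3 k).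
Proof.
move=> S0 e0 S4 Se c1 c2 c3 k.
have S3 : 3 * S < 1 by lra.
have S2 : 2 * S <= 1 by lra.
have [n1 b1] := in_cone_bounds S0 S2 l0 c1.
have [n2 b2] := in_cone_bounds S0 S2 l0 c2.
have [n3 b3] := in_cone_bounds S0 S2 l0 c3.
set N1 := \sum_j f1 j in n1 b1; set N2 := \sum_j f2 j in n2 b2; set N3 := \sum_j f3 j in n3 b3.
(* N is the value the product would have if the three factors were constant with the same sums. *)
pose N := N1 * (N2 * N3) / 64.
have N0 : 0 <= N by rewrite divr_ge0 // !mulr_ge0.
have lb j : (1 - 3 * S) ^+ 3 * N <= f1 j * (f2 j * f3 j).
  have /andP[h1 _] := b1 j; have /andP[h2 _] := b2 j; have /andP[h3 _] := b3 j.
  have pos x : 0 <= x -> 0 <= (1 - 3 * S) / 4 * x by move=> x0; rewrite !mulr_ge0 //; lra.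
  have -> : (1 - 3 * S) ^+ 3 * N = ((1 - 3 * S) / 4 * N1) * (((1 - 3 * S) / 4 * N2) * ((1 - 3 * S) / 4 * N3)).
    by rewrite /N; field.
  apply: ler_pM => //; [exact: pos|by rewrite mulr_ge0 ?pos|].
  by apply: ler_pM => //; exact: pos.
have ub j : f1 j * (f2 j * f3 j) <= (1 + 3 * S) ^+ 3 * N.
  have /andP[h1 g1] := b1 j; have /andP[h2 g2] := b2 j; have /andP[h3 g3] := b3 j.
  have pos x y : 0 <= x -> (1 - 3 * S) / 4 * x <= y -> 0 <= y.
    by move=> x0; apply: le_trans; rewrite !mulr_ge0 //; lra.
  have -> : (1 + 3 * S) ^+ 3 * N = ((1 + 3 * S) / 4 * N1) * (((1 + 3 * S) / 4 * N2) * ((1 + 3 * S) / 4 * N3)).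
    by rewrite /N; field.
  have p1 := pos _ _ n1 h1; have p2 := pos _ _ n2 h2; have p3 := pos _ _ n3 h3.
  by apply: ler_pM => //; [rewrite mulr_ge0|apply: ler_pM].
have [e4|e4] := leP 4^-1 eps.
  apply: (@le_trans _ _ 0); last by apply: le_trans (lb k); rewrite mulr_ge0 ?exprn_ge0 //; lra.
  rewrite mulr_le0_ge0 ?subr_le0 // sumr_ge0 // => j _.
  by apply: le_trans (lb j); rewrite mulr_ge0 ?exprn_ge0 //; lra.
apply: le_trans (lb k).
apply: (@le_trans _ _ ((4^-1 - eps) * (4 * ((1 + 3 * S) ^+ 3 * N)))).
  rewrite ler_pM2l ?subr_gt0 // sum_spin.
  by move: (ub k0) (ub k1) (ub k2) (ub k3); lra.
have -> : (4^-1 - eps) * (4 * ((1 + 3 * S) ^+ 3 * N)) = ((4^-1 - eps) * 4 * (1 + 3 * S) ^+ 3) * N by ring.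
rewrite ler_wpM2r //.
set y := 3 * S.
have y0 : 0 <= y by rewrite /y; lra.
have ye : 10 * y <= 4 * eps by rewrite /y; lra.
have y1 : y <= 1 by rewrite /y; lra.
have a1 : 1 - 3 * y <= (1 - y) ^+ 3 by nra.
have a2 : (1 + y) ^+ 3 <= 1 + 7 * y by nra.
apply: le_trans a1; apply: (@le_trans _ _ ((4^-1 - eps) * 4 * (1 + 7 * y))).
  by rewrite ler_wpM2l //; lra.
nra.
Qed.

Lemma tree_weight_site n v k (sigma : configuration) : (size v < n)%N ->
  tree_weight K n (site_indicator v k) sigma =
  (sigma v == k)%:R * tree_weight K n (fun _ _ => 1) sigma.
Proof.
move=> vn; rewrite /tree_weight big_split /= [in RHS]big_split /= big1_eq mul1r.
congr (_ * _); rewrite (bigD1_seq v) ?mem_ball ?uniq_ball //= big1 ?mulr1.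
  by rewrite /site_indicator eqxx.
by move=> w /negPf wv; rewrite /site_indicator wv.
Qed.

Lemma expR_energy_sphere n delta (omega : {ffun interior (sphere n) -> spin}) :
  expR (- energy 2%:R^-1 l delta omega) = tree_weight K n (fun _ _ => 1) (glue omega delta).
Proof.
rewrite expR_energy //; last exact: cutset_sphere.
under eq_bigr => x _ do rewrite -(glue_val omega delta).
rewrite -(big_seq_fsetE _ (interior (sphere n)) predT
  (fun x => \prod_(b : bool) M 2^-1 l (glue omega delta x) (glue omega delta (rcons x b)))) /=.
rewrite /tree_weight; under [RHS]eq_bigr => x _ do rewrite mul1r.
apply: perm_big; apply: uniq_perm; rewrite ?uniq_ball ?fset_uniq // => x.
by rewrite mem_ball -mem_interior_sphere.
Qed.

(** Seen from v, the weight of the event that v has spin k is a product of three functions in a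
    small cone, whatever the boundary condition; hence it depends little on k. *)
Lemma finite_volume_site_ge v (eps : R) : 0 < eps -> exists2 n, (size v < n)%N & forall delta k,
  4^-1 - eps <= \sum_(omega : {ffun interior (sphere n) -> spin} | glue omega delta v == k)
     finite_volume_gibbs 2%:R^-1 l delta omega.
Proof.
move=> e0.
have [d hd] : exists d, radius d < Num.min 4^-1 (4 * eps / 30).
  by apply: radius_lim; rewrite lt_min; apply/andP; split; lra.
move: hd; rewrite lt_min => /andP[hd1 hd2].
exists (size v + d).+1 => [|delta k]; first by rewrite ltnS leq_addr.
set n := (size v + d)%N.
(* The start g = 1 lies in every cone. With n = |v| + d, all messages met along the path come from
   depth at least d. *)
have [|||||g' [m0 [m1 [c1 c2 c3 E]]]] := @message_path R K (in_cone l (radius d)) n v delta (fun=> 1).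
- by move=> i j; exact: M_sym.
- by move=> f h; exact: cone_closed.
- by move=> e eta; rewrite /n addKn; exact: in_cone_message.
- by rewrite leq_addr.
- exact: in_cone1.
have S0 := radius_gt0 d.
have S4 : 4 * radius d <= 1 by lra.
have Se : 30 * radius d <= 4 * eps by lra.
have lb := in_cone_product S0 e0 S4 Se c1 c2 c3 k.
have num j : \sum_(omega : {ffun interior (sphere n.+1) -> spin} | glue omega delta v == j)
    expR (- energy 2%:R^-1 l delta omega) = g' j * (m0 j * m1 j).
  rewrite -E big_mkcond /=.
  rewrite -(sum_tree_weightS (fun=> 1)); last by move=> b i; exact: sum_tree_weight.
  rewrite -(sum_glue n.+1 delta (fun s => 1 * tree_weight K n.+1 (site_indicator v j) s)).
  apply: eq_bigr => omega _; rewrite mul1r tree_weight_site ?ltnS ?leq_addr // expR_energy_sphere.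
  by case: eqP; rewrite ?mul1r ?mul0r.
have den : partition_function 2%:R^-1 l (sphere n.+1) delta = \sum_j g' j * (m0 j * m1 j).
  rewrite /partition_function (partition_big (fun omega => glue omega delta v) predT) //=.
  by apply: eq_bigr => j _; rewrite -num; apply: eq_bigl => omega.
rewrite /finite_volume_gibbs -mulr_suml num ler_pdivlMr ?partition_function_gt0 //.
by rewrite den.
Qed.

End Uniqueness.

(** * Events depending on finitely many sites *)

Lemma measure_finType d (T : measurableType d) (R : realType) (mu : {measure set T -> \bar R})
    (I : finType) (P : pred I) (F : I -> set T) :
  (forall i, measurable (F i)) -> (forall i j, F i `&` F j !=set0 -> i = j) ->
  mu (\bigcup_(i in [set` P]) F i) = (\sum_(i | P i) mu (F i))%E.
Proof.
move=> mF tF; rewrite measure_fin_bigcup //; last by move=> i j _ _; exact: tF.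
by rewrite [RHS]bigfs ?index_enum_uniq // => i _; rewrite mem_index_enum.
Qed.

Lemma sigma_finType_bigcup (T : pointedType) (G : set (set T)) (I : finType) (F : I -> set T) :
  (forall i, <<s G >> (F i)) -> <<s G >> (\bigcup_i F i).
Proof.
move=> mF.
exact: (@fin_bigcup_measurable _ (g_sigma_algebraType G) I setT F finite_finset (fun i _ => mF i)).
Qed.

(** By induction on the sites: A is split along the four values at v, and fixing that value leaves
    an event determined by the other sites. *)
Lemma local_sigma (D : set vertex) (s : seq vertex) (A : set configuration) :
  (forall v, v \in s -> D v) ->
  (forall w w' : configuration, {in s, w =1 w'} -> A w -> A w') ->
  <<s cylinders D >> A.
Proof.
elim: s A => [|v s IH] A sD loc.
  have [[w Aw]|/forallNP A0] := pselect (exists w, A w).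
    suff -> : A = setT by exact: (@measurableT _ (g_sigma_algebraType (cylinders D))).
    by apply/seteqP; split=> // w' _; exact: (loc w).
  suff -> : A = set0 by exact: (@measurable0 _ (g_sigma_algebraType (cylinders D))).
  by apply/seteqP; split=> // w /A0.
pose upd (w : configuration) (k : spin) : configuration := fun x => if x == v then k else w x.
have -> : A = \bigcup_(k : spin) ([set w | w v = k] `&` [set w | A (upd w k)]).
  apply/seteqP; split=> [w Aw|w [k _ [/= wv Ak]]].
    exists (w v) => //; split=> //=; apply: loc Aw => x _; rewrite /upd.
    by case: eqP => // ->.
  by apply: loc Ak => x _; rewrite /upd; case: eqP => [->|].
apply: sigma_finType_bigcup => k.
apply: (@measurableI _ (g_sigma_algebraType (cylinders D))).
  by apply: sub_gen_smallest; exists v; [apply: sD; rewrite mem_head|exists k].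
apply: IH => [x xs|w w' ww']; first by apply: sD; rewrite inE xs orbT.
apply: loc => x; rewrite inE /upd; case: eqP => //= _; exact: ww'.
Qed.

Lemma measurable_local (s : seq vertex) (A : set config_space) :
  (forall w w' : configuration, {in s, w =1 w'} -> A w -> A w') -> measurable A.
Proof. by move=> loc; apply: (local_sigma (D := setT)) loc. Qed.

Lemma measurable_fun_local (s : seq vertex) d (T : measurableType d) (f : config_space -> T) :
  (forall w w' : configuration, {in s, w =1 w'} -> f w = f w') -> measurable_fun setT f.
Proof.
move=> loc _ B mB; rewrite setTI; apply: (@measurable_local s) => w w' ww'.
by rewrite /preimage /= (loc _ _ ww').
Qed.

(** * Integrating finite-volume estimates against a Gibbs measure *)

Section Gibbs.
Context {R : realType}.
Variables (lambda1 lambda2 : R).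

Lemma finite_volume_gibbs_local (C : {fset vertex}) (omega : {ffun interior C -> spin})
   (w w' : configuration) : {in C, w =1 w'} ->
  finite_volume_gibbs lambda1 lambda2 w omega = finite_volume_gibbs lambda1 lambda2 w' omega.
Proof.
move=> ww'.
have en (o : {ffun interior C -> spin}) : energy lambda1 lambda2 w o = energy lambda1 lambda2 w' o :> R.
  rewrite /energy; congr (_ + _); apply: eq_bigr => x _; apply: eq_bigr => y _.
  by rewrite ww' //; exact: fsvalP.
by rewrite /finite_volume_gibbs /partition_function en; under eq_bigr => o _ do rewrite en.
Qed.

Lemma finite_volume_gibbs_ge0 (C : {fset vertex}) (omega : {ffun interior C -> spin}) w :
  0 <= finite_volume_gibbs lambda1 lambda2 w omega.
Proof. by rewrite divr_ge0 ?expR_ge0 // ltW // partition_function_gt0. Qed.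

Lemma measurable_finite_volume_gibbs (C : {fset vertex}) (omega : {ffun interior C -> spin}) :
  measurable_fun (setT : set config_space)
    ((fun delta => (finite_volume_gibbs lambda1 lambda2 delta omega)%:E) : config_space -> \bar R).
Proof.
apply: (@measurable_fun_local (enum_fset C)) => w w' ww'.
by congr (_%:E); apply: finite_volume_gibbs_local.
Qed.

Lemma measurable_interior_event (C : {fset vertex}) (omega : {ffun interior C -> spin}) :
  measurable ([set w | forall x : interior C, w (val x) = omega x] : set config_space).
Proof.
apply: (@measurable_local (enum_fset (interior C))) => w w' ww' /= h x.
by rewrite -ww' //; exact: fsvalP.
Qed.

(** The conditional law is integrated over the sure event and summed over the interior
    configurations with spin k at v. *)
Lemma gibbs_marginal_ge (mu : probability config_space R) (C : {fset vertex}) v k (p : R) :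
  0 <= p -> cutset C -> gibbs_measure lambda1 lambda2 mu -> v \in interior C ->
  (forall delta, p <= \sum_(omega : {ffun interior C -> spin} | glue omega delta v == k)
     finite_volume_gibbs lambda1 lambda2 delta omega) ->
  (p%:E <= marginal mu v k)%E.
Proof.
move=> p0 cC gm vC hp.
pose E (omega : {ffun interior C -> spin}) := [set w : config_space | forall x : interior C, w (val x) = omega x].
pose P (omega : {ffun interior C -> spin}) := omega [` vC]%fset == k.
have gl omega delta : glue omega delta v = omega [` vC]%fset.
  by rewrite -[v in LHS]/(val [` vC]%fset) glue_val.
have -> : marginal mu v k = (\sum_(omega | P omega) mu (E omega))%E.
  rewrite -measure_finType; first 1 last.
  - exact: measurable_interior_event.
  - by move=> o o' [w [/= h h']]; apply/ffunP => x; rewrite -h -h'.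
  congr (mu _); apply/seteqP; split=> w /=.
    move=> wv; exists [ffun x => w (val x)]; last by move=> x; rewrite ffunE.
    by apply/eqP; rewrite ffunE.
  by move=> [omega /eqP oP /= wE]; rewrite -oP -wE.
have -> : (\sum_(omega | P omega) mu (E omega) =
   \int[mu]_delta (\sum_(omega | P omega) (finite_volume_gibbs lambda1 lambda2 delta omega)%:E))%E.
  under eq_integral => delta _ do rewrite big_mkcond /=.
  rewrite ge0_integral_sum //.
  - rewrite big_mkcond; apply: eq_bigr => omega _; case: ifP => _; last by rewrite integral0.
    rewrite -(gm C cC omega setT) ?setIT //.
    exact: (@measurableT _ (g_sigma_algebraType (cylinders (~` [set` interior C])))).
  - by move=> omega; case: (P omega); [exact: measurable_finite_volume_gibbs|exact: measurable_cst].
  - by move=> omega delta _; case: (P omega); rewrite // lee_fin finite_volume_gibbs_ge0.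
apply: (@le_trans _ _ (\int[mu]_(delta in setT) (cst p%:E delta))%E).
  rewrite integral_cst; last exact: measurableT.
  by have h := probability_setT mu; rewrite [X in (_ <= _ * X)%E](_ : _ = 1%E) ?mule1 //; exact: h.
apply: ge0_le_integral => //.
- apply: (@measurable_fun_local (enum_fset C)) => w w' ww'; apply: eq_bigr => omega _.
  by rewrite (finite_volume_gibbs_local omega ww').
- by move=> delta _; rewrite sumEFin lee_fin; have := hp delta; under eq_bigl => o do rewrite gl.
Qed.

End Gibbs.

(** * Uniform marginals and the range of lambda2 *)

Section Marginals.
Context {R : realType}.

Lemma sum_marginal (mu : probability config_space R) v :
  (\sum_(k : spin) marginal mu v k = 1)%E.
Proof.
rewrite -(@measure_finType _ _ _ mu _ predT (fun k : spin => [set w : config_space | w v = k])).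
- have := probability_setT mu; congr (_ = _); congr (mu _).
  by apply/seteqP; split=> w // _; exists (w v).
- by move=> k; apply: sub_gen_smallest; exists v => //; exists k.
- by move=> i j [w [/= <- <-]].
Qed.

(** Every probability is at least 1/4 - eps for all eps > 0, and four numbers that are at least 1/4
    with sum 1 equal 1/4. *)
Lemma gibbs_marginal_uniform (l : R) (mu : probability config_space R) v :
  0 < l -> 3 * l <= 1 -> (forall i j, 0 < M 2%:R^-1 l i j) ->
  gibbs_measure 2%:R^-1 l mu -> marginal mu v = equidistribution.
Proof.
move=> l0 l3 M0 gm.
have fin k : marginal mu v k = (fine (marginal mu v k))%:E.
  rewrite fineK // fin_num_measure //.
  by apply: sub_gen_smallest; exists v => //; exists k.
have lb k : 4^-1 <= fine (marginal mu v k).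
  apply/ler_addgt0Pr => e e0.
  (* Keeps the lower bound 1/4 - e non-negative, as [gibbs_marginal_ge] requires. *)
  wlog e4 : e e0 / e <= 4^-1.
    move=> h; have [e4|/ltW e4] := leP e 4^-1; first exact: h.
    by apply: le_trans (h 4^-1 _ _) _; rewrite ?lerD2l.
  have [n vn hn] := finite_volume_site_ge l0 l3 M0 v e0.
  rewrite -lerBlDr -lee_fin -fin.
  apply: (@gibbs_marginal_ge _ 2^-1 l mu (sphere n)) => //.
  - by rewrite subr_ge0.
  - exact: cutset_sphere.
  - by rewrite mem_interior_sphere.
have := sum_marginal mu v; under eq_bigr => k _ do rewrite fin.
rewrite sumEFin sum_spin => -[s1].
apply/funext => k; rewrite fin /equidistribution; congr (_%:E).
move: (lb k0) (lb k1) (lb k2) (lb k3).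
by elim/spin_ind: k; lra.
Qed.

Section ModelBounds.
Variable l : R.
Hypothesis hm : generalized_clock_model 2%:R^-1 l.

Lemma clock_model_gt0 : 0 < l.
Proof.
have [pos _ _] := hm; have := pos k0 k2; rewrite M_first_row /first_row /=; lra.
Qed.

Lemma clock_model_le_half : 2 * l <= 1.
Proof.
have [_ mono _] := hm; have := mono k0 k2 k0 k1.
rewrite !M_first_row /first_row /=.
have -> : dist k0 k1 = 1 :> R.
  rewrite /dist /= sub0r mulrN mulr1 mulNr cosN.
  by rewrite (_ : 2 * pi / 4 = pi / 2); [rewrite cos_pihalf subr0|field].
have -> : dist k0 k2 = 2 :> R.
  rewrite /dist /= sub0r mulrN mulNr cosN.
  by rewrite (_ : 2 * pi * 2 / 4 = pi); [rewrite cospi opprK|field].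
by move=> /(_ _); lra.
Qed.

(** At l = 1/2 the matrix M - 1/2 has all entries equal to 1/8, hence rank at most one, and the
    eigenspace has dimension at least three. *)
Lemma clock_model_neq_half : l <> 2^-1.
Proof.
move=> lE; have [_ _] := hm; rewrite lE => rk.
have : (3 <= \rank (eigenspace (M (2%:R^-1 : R) 2^-1) 2%:R^-1))%N.
  rewrite /eigenspace mxrank_ker.
  have -> : M (2%:R^-1 : R) 2^-1 - (2^-1)%:M = (const_mx 8^-1 : 'cV_4) *m (const_mx 1 : 'rV_4).
    apply/matrixP => i j; rewrite !mxE big_ord1 !mxE mulr1 /first_row.
    by elim/spin_ind: i; elim/spin_ind: j; rewrite /= ?mulr1n ?mulr0n; field.
  by apply: (@leq_trans (4 - 1)) => //; rewrite leq_sub2l // mulmx_max_rank.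
by rewrite rk.
Qed.

Lemma clock_model_lt_half : l < 2^-1.
Proof.
rewrite lt_neqAle; apply/andP; split; first by apply/eqP; exact: clock_model_neq_half.
by have := clock_model_le_half; lra.
Qed.

End ModelBounds.
End Marginals.

(** * Sampling a process with values in the spins *)

Section Process.
Context {R : realType}.
Variable step : seq spin -> spin -> R.

(** Here [step s k] is the conditional probability that the spins s are followed by k, so this is
    the probability that the process starts with s. *)
Definition word_weight (s : seq spin) : R :=
  \prod_(i < size s) step (take i s) (nth ord0 s i).

Lemma word_weight_rcons s k : word_weight (rcons s k) = word_weight s * step s k.
Proof.
rewrite /word_weight size_rcons big_ord_recr /=; congr (_ * _).
  apply: eq_bigr => i _; rewrite nth_rcons ltn_ord -cats1 take_cat.
  by rewrite ltn_ord.
by rewrite nth_rcons ltnn eqxx -cats1 take_size_cat.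
Qed.

(** The cells of the four extensions of s are laid side by side inside the cell of s; this is the
    distance from its left end to the cell of [rcons s k]. *)
Definition offset (s : seq spin) (k : spin) : R :=
  \sum_(j : spin | (j < k)%N) word_weight (rcons s j).

Definition left_end (s : seq spin) : R :=
  \sum_(i < size s) offset (take i s) (nth ord0 s i).

Lemma left_end_rcons s k : left_end (rcons s k) = left_end s + offset s k.
Proof.
rewrite /left_end size_rcons big_ord_recr /=; congr (_ + _).
  apply: eq_bigr => i _; rewrite nth_rcons ltn_ord -cats1 take_cat.
  by rewrite ltn_ord.
by rewrite nth_rcons ltnn eqxx -cats1 take_size_cat.
Qed.

Lemma offsetE s : [/\ offset s k0 = 0, offset s k1 = word_weight (rcons s k0),
   offset s k2 = word_weight (rcons s k0) + word_weight (rcons s k1) &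
   offset s k3 = word_weight (rcons s k0) + word_weight (rcons s k1) + word_weight (rcons s k2)].
Proof.
by rewrite /offset; split; rewrite big_mkcond sum_spin /= ?addr0 ?add0r.
Qed.

Definition digit (s : seq spin) (u : R) : spin :=
  if u < left_end s + offset s k1 then k0 else
  if u < left_end s + offset s k2 then k1 else
  if u < left_end s + offset s k3 then k2 else k3.

Fixpoint word (u : R) n : seq spin :=
  if n is n'.+1 then rcons (word u n') (digit (word u n') u) else [::].

Lemma size_word u n : size (word u n) = n.
Proof. by elim: n => //= n IH; rewrite size_rcons IH. Qed.

Definition cell s : set R := `[left_end s, left_end s + word_weight s[%classic.

Lemma measurable_digit s k : measurable [set u | digit s u = k].
Proof.
have mlt (x : R) : measurable [set u : R | u < x].
  by rewrite (_ : [set u | u < x] = `]-oo, x[%classic) //; apply/seteqP; split=> u /=; rewrite in_itv.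
have -> : [set u | digit s u = k] =
  \bigcup_(b in [set b : bool * bool * bool | (if b.1.1 then k0 else if b.1.2 then k1 else if b.2 then k2 else k3) = k])
    ([set u | (u < left_end s + offset s k1) = b.1.1] `&`
     [set u | (u < left_end s + offset s k2) = b.1.2] `&`
     [set u | (u < left_end s + offset s k3) = b.2]).
  apply/seteqP; split=> u /=.
    by move=> uk; exists (u < left_end s + offset s k1, u < left_end s + offset s k2, u < left_end s + offset s k3).
  by move=> [[[b1 b2] b3] /= bk [[e1 e2] e3]]; rewrite /digit e1 e2 e3.
have mb (x : R) (b : bool) : measurable [set u : R | (u < x) = b].
  case: b; first exact: mlt.
  rewrite (_ : [set u | _] = ~` [set u | u < x]); first exact: measurableC.
  by apply/seteqP; split=> u /= /negP; [move/negP|]; case: (u < x).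
by apply: fin_bigcup_measurable => // b _; do 2?apply: measurableI.
Qed.

Lemma measurable_word n s : measurable [set u | word u n = s].
Proof.
elim: n s => [|n IH] s /=.
  case: s => [|k s]; first by rewrite (_ : [set u | _] = setT) //; apply/seteqP; split.
  by rewrite (_ : [set u | _] = set0) //; apply/seteqP; split.
case/lastP: s => [|s k].
  rewrite (_ : [set u | _] = set0) //; apply/seteqP; split=> // u /= /(congr1 size).
  by rewrite size_rcons.
rewrite (_ : [set u | _] = [set u | word u n = s] `&` [set u | digit s u = k]).
  by apply: measurableI => //; exact: measurable_digit.
apply/seteqP; split=> u /=; first by move/rcons_inj => [<- <-].
by move=> [-> ->].
Qed.

Hypothesis step_ge0 : forall s k, 0 <= step s k.
Hypothesis step_sum : forall s, \sum_k step s k = 1.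

Lemma word_weight_ge0 s : 0 <= word_weight s.
Proof. by apply: prodr_ge0. Qed.

Lemma word_weight_sum s : \sum_k word_weight (rcons s k) = word_weight s.
Proof.
by under eq_bigr => k _ do rewrite word_weight_rcons; rewrite -mulr_sumr step_sum mulr1.
Qed.

Lemma cell_rcons s k u : cell (rcons s k) u <-> cell s u /\ digit s u = k.
Proof.
rewrite /cell /= !in_itv /= left_end_rcons /digit.
have [d0 d1 d2 d3] := offsetE s.
have p k' := word_weight_ge0 (rcons s k').
rewrite -(word_weight_sum s) sum_spin.
move: (p k0) (p k1) (p k2) (p k3) => p0 p1 p2 p3.
rewrite d1 d2 d3.
have [h1|h1] := ltP u (left_end s + word_weight (rcons s k0));
  [|have [h2|h2] := ltP u (left_end s + (word_weight (rcons s k0) + word_weight (rcons s k1)));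
  [|have [h3|h3] := ltP u (left_end s +
     (word_weight (rcons s k0) + word_weight (rcons s k1) + word_weight (rcons s k2)))]];
  move: k; apply: spin_ind; rewrite ?d0 ?d1 ?d2 ?d3; clear d0 d1 d2 d3 p;
  (split=> [/andP[a b]|[/andP[a b] e]]; [split; [apply/andP; split; lra|first [done|exfalso; lra]]|
    first [discriminate e|apply/andP; split; lra]]).
Qed.

Lemma cell_nil : cell [::] = `[0, 1[%classic.
Proof. by rewrite /cell /left_end /word_weight !big_ord0 add0r. Qed.

Lemma cell_sub s : cell s `<=` `[0, 1[%classic.
Proof.
elim/last_ind: s => [|s k IH]; first by rewrite cell_nil.
by move=> u /cell_rcons[/IH].
Qed.

Lemma cell_word s u : `[0, 1[%classic u -> word u (size s) = s <-> cell s u.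
Proof.
move=> u01; elim/last_ind: s => [|s k IH]; first by rewrite cell_nil.
rewrite size_rcons /=; split=> [/rcons_inj[ws dk]|/cell_rcons[cs dk]].
  by apply/cell_rcons; split; [apply/IH|rewrite -dk ws].
by move/IH: cs => ->; rewrite dk.
Qed.

Let P : probability (measurableTypeR R) R := uniform_prob (ltr01 : 0 < 1 :> R).

Lemma uniform_prob_itv (a b : R) : 0 <= a -> a <= b -> b <= 1 ->
  P `[a, b[%classic = (b - a)%:E.
Proof.
move=> a0 ab b1; rewrite /P /uniform_prob.
transitivity (\int[lebesgue_measure]_(x in `[a, b[%classic) (cst 1%:E x))%E.
  apply: eq_integral => x; rewrite inE /= in_itv /= => /andP[xa xb].
  rewrite /uniform_pdf subr0 invr1 ifT //; apply/andP; split; lra.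
rewrite integral_cst //= lebesgue_measure_itv /= mul1e lte_fin.
case: ltP => // ba; congr (_%:E); lra.
Qed.

Lemma uniform_prob_word s : P [set u | word u (size s) = s] = (word_weight s)%:E.
Proof.
have m01 : measurable (`[0, 1[%classic : set R) by exact: measurable_itv.
have mw := measurable_word (size s) s.
have P01 : P `[0, 1[%classic = 1%E by rewrite uniform_prob_itv ?subr0.
have PC : P (~` `[0, 1[%classic) = 0%E.
  by have := probability_setC P m01; rewrite P01 subee.
have cE : [set u | word u (size s) = s] `&` `[0, 1[%classic = cell s.
  apply/seteqP; split=> u /=; first by move=> [h u01]; apply/cell_word.
  by move=> cu; have u01 := cell_sub cu; split=> //; apply/cell_word.
(* Points outside [0, 1[ also spell words, but they have probability zero. *)
have split_P : P [set u | word u (size s) = s] = P (cell s).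
  apply/eqP; rewrite eq_le; apply/andP; split; last first.
    by rewrite -cE; exact: measureIl.
  rewrite -cE (measureDI P mw m01).
  rewrite [X in (X + _)%E](_ : _ = 0%E) ?add0e //.
  apply: (subset_measure0 _ _ _ PC); [exact: measurableD|exact: measurableC|by move=> u []].
have s0 : 0 <= left_end s by do 2!apply: sumr_ge0 => ? _; exact: word_weight_ge0.
have s1 : left_end s + word_weight s <= 1.
  elim/last_ind: (s) => [|t k]; first by rewrite /left_end /word_weight !big_ord0 add0r.
  apply: le_trans; rewrite left_end_rcons -addrA lerD2l -(word_weight_sum t) sum_spin.
  have [d0 d1 d2 d3] := offsetE t.
  have p j := word_weight_ge0 (rcons t j).
  move: (p k0) (p k1) (p k2) (p k3) => p0 p1 p2 p3.
  by move: k; apply: spin_ind; rewrite ?d0 ?d1 ?d2 ?d3; lra.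
rewrite split_P uniform_prob_itv ?lerDl ?word_weight_ge0 //.
by rewrite addrAC subrr add0r.
Qed.

Lemma word_mkseq u n (s : nat -> spin) :
  word u n = mkseq s n <-> forall i, (i < n)%N -> digit (word u i) u = s i.
Proof.
elim: n => [|n IH] //=; rewrite mkseqS; split=> [/rcons_inj[/IH h hn] i|h].
  by rewrite ltnS leq_eqVlt => /orP[/eqP->|/h].
by rewrite (h n) // (proj2 IH) // => i ni; apply: h; exact: ltnW.
Qed.

Variables (idx : vertex -> nat) (e : nat -> vertex).
Hypothesis idxK : forall n, idx (e n) = n.

Definition process (u : measurableTypeR R) : config_space :=
  fun v => digit (word u (idx v)) u.

Lemma measurable_process : measurable_fun setT process.
Proof.
apply: (@measurability _ _ (measurableTypeR R) config_space setT process (cylinders setT)) => //.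
move=> _ [_ [v _ [k ->]] <-]; rewrite setTI.
rewrite (_ : _ @^-1` _ = \bigcup_(t : (idx v).-tuple spin)
   ([set u | word u (idx v) = t] `&` [set u | digit t u = k])).
  apply: fin_bigcup_measurable => // t _; apply: measurableI.
    exact: measurable_word.
  exact: measurable_digit.
apply/seteqP; split=> u /=.
  move=> uk; exists (Tuple (introT eqP (size_word u (idx v)))) => //.
by move=> [t _ [/= wt]]; rewrite /process wt.
Qed.

Lemma exists_process : exists mu : probability config_space R, forall n (s : nat -> spin),
  mu [set w : config_space | forall i, (i < n)%N -> w (e i) = s i] =
  (\prod_(i < n) step (mkseq s i) (s i))%:E.
Proof.
pose X : {mfun (measurableTypeR R) >-> config_space} := mfun_Sub (mem_set measurable_process).
exists (distribution P X) => n s.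
rewrite /distribution /pushforward.
transitivity (P [set u | word u (size (mkseq s n)) = mkseq s n]).
  congr (P _); apply/seteqP; rewrite size_mkseq; split=> u /=.
    by move=> h; apply/word_mkseq => i ni; rewrite -(h i ni) /process idxK.
  by move/word_mkseq => h i ni; rewrite /process idxK h.
rewrite uniform_prob_word //; congr (_%:E).
rewrite /word_weight size_mkseq; apply: eq_bigr => i _; rewrite nth_mkseq //.
by rewrite /mkseq -map_take take_iota (minn_idPl _) // ltnW.
Qed.

End Process.

(** * The Markov chain of a boundary law *)

(* Position of a vertex in the breadth-first enumeration, in which the
   children of the j-th vertex are the (2j+1)-th and the (2j+2)-th. *)
Definition heap (v : vertex) : nat := foldl (fun i (b : bool) => (i.*2 + b).+1) 0%N v.

Lemma heap_rcons v b : heap (rcons v b) = ((heap v).*2 + b).+1.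
Proof. by rewrite /heap -cats1 foldl_cat. Qed.

Lemma heap_inj : injective heap.
Proof.
elim/last_ind => [|v b IH] w; case/lastP: w => [|w c] //; rewrite !heap_rcons //= => -[E].
have bc : b = c by move/(congr1 odd): E; rewrite !oddD !odd_double /= !oddb.
by move: E; rewrite bc => /addIn/double_inj/IH ->.
Qed.

Lemma heap_surj n : exists v, heap v == n.
Proof.
elim/ltn_ind: n => -[_|n IH]; first by exists [::].
(* The vertex of index n + 1 has its parent at index n / 2, and the parity of n tells which child it
   is. *)
have [|v /eqP vn] := IH n./2; first by rewrite ltnS -{2}(odd_double_half n) -addnn addnA leq_addl.
by exists (rcons v (odd n)); rewrite heap_rcons vn addnC odd_double_half.
Qed.

Definition vert n : vertex := xchoose (heap_surj n).

Lemma vertK n : heap (vert n) = n.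
Proof. exact/eqP/(xchooseP (heap_surj n)). Qed.

Lemma heapK v : vert (heap v) = v.
Proof. by apply: heap_inj; rewrite vertK. Qed.

Lemma vert_child j (b : bool) : vert (j.*2 + b).+1 = rcons (vert j) b.
Proof. by apply: heap_inj; rewrite vertK heap_rcons vertK. Qed.

Section BoundaryLaw.
Context {R : realType}.
Variables (K : spin -> spin -> R) (g : spin -> R) (c : R).
Hypothesis K_gt0 : forall i j, 0 < K i j.
Hypothesis g_gt0 : forall k, 0 < g k.
Hypothesis c_gt0 : 0 < c.
Hypothesis law : forall k, \sum_j K k j * g j ^+ 2 = c * g k.

Let H := \sum_k g k ^+ 2.

Lemma sum_sqr_gt0 : 0 < H.
Proof.
by rewrite /H (bigD1 ord0) //= ltr_pwDl ?exprn_gt0 // sumr_ge0 // => i _; rewrite exprn_ge0 ?ltW.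
Qed.

(* The spin of index i is drawn given that of its parent, (i-1)/2. *)
Definition chain_step (s : seq spin) (k : spin) : R :=
  if s is [::] then g k ^+ 2 / H else
  let p := nth ord0 s (size s).-1./2 in K p k * g k ^+ 2 / (c * g p).

Lemma chain_step_ge0 s k : 0 <= chain_step s k.
Proof.
case: s => [|j s] /=; first by rewrite divr_ge0 ?exprn_ge0 ?ltW // sum_sqr_gt0.
by rewrite divr_ge0 ?mulr_ge0 ?exprn_ge0 ?ltW.
Qed.

Lemma chain_step_sum s : \sum_k chain_step s k = 1.
Proof.
case: s => [|j s]; first by rewrite -mulr_suml divff // gt_eqF // sum_sqr_gt0.
by rewrite /chain_step -mulr_suml law divff // gt_eqF // mulr_gt0.
Qed.

(** Law of the spins of index at most 2 L. These indices form a subtree in which those below L have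
    both children, and the leaves L, ..., 2 L carry the boundary law squared. *)
Definition chain_weight L (s : nat -> spin) : R :=
  (H * c ^+ L.*2)^-1 * (\prod_(j < L) \prod_(b : bool) K (s j) (s (j.*2 + b).+1)) *
  \prod_(L <= i < L.*2.+1) g (s i) ^+ 2.

(* The factors g telescope because the two children of a vertex j contribute
   the denominator (c g(s j))^2. *)
Lemma chain_weightE L s :
  \prod_(i < L.*2.+1) chain_step (mkseq s i) (s i) = chain_weight L s.
Proof.
have Hn0 : H != 0 by rewrite gt_eqF // sum_sqr_gt0.
have cn0 : c != 0 by rewrite gt_eqF.
have gn0 k : g k != 0 by rewrite gt_eqF.
rewrite -(big_mkord xpredT (fun i => chain_step (mkseq s i) (s i))).
elim: L => [|L IH].
  by rewrite big_nat1 /chain_weight big_ord0 big_nat1 /= expr0 !mulr1 mulrC.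
rewrite doubleS 2?big_nat_recr // IH /chain_weight big_ord_recr big_bool.
have st i k : (L < i)%N -> i.-1./2 = L -> chain_step (mkseq s i) k = K (s L) k * g k ^+ 2 / (c * g (s L)).
  move=> Li iL; rewrite /chain_step size_mkseq iL nth_mkseq //.
  by case: i Li iL.
rewrite (st L.*2.+1) ?ltnS ?uphalf_double ?doubleK //; try by rewrite -addnn leq_addr.
rewrite (st L.*2.+2) ?ltnS /= ?uphalf_double //; try by rewrite leqW // -addnn leq_addr.
rewrite doubleS addn1 addn0.
rewrite (@big_ltn _ _ _ L) ?ltnS; last by rewrite -addnn leq_addr.
have le1 : (L.+1 <= L.*2.+1)%N by rewrite ltnS -addnn leq_addr.
rewrite [in RHS](big_nat_recr L.*2.+2) ?(leqW le1) //= (big_nat_recr L.*2.+1) //=.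
rewrite !exprS; field.
by rewrite Hn0 cn0 gn0 expf_neq0.
Qed.

End BoundaryLaw.

Lemma adde_fin_inj (R : numDomainType) (x y z : \bar R) :
  x \is a fin_num -> (y + x = z + x)%E -> y = z.
Proof. by case: x y z => [x| |] [y| |] [z| |] // _ [/addIr->]. Qed.

(** * The Markov chain is a Gibbs measure *)

Section GibbsChain.
Context {R : realType}.
Variables (lambda1 lambda2 : R) (g : spin -> R) (c : R).
Let K : spin -> spin -> R := fun_of_matrix (M lambda1 lambda2).
Hypothesis K_gt0 : forall i j, 0 < K i j.

(** If all interior indices are below L, every edge at an interior vertex appears in the chain
    weight and no leaf is interior. The remaining factors involve only exterior spins and form r. *)
Lemma chain_weight_glue (C : {fset vertex}) L delta : cutset C ->
  (forall x, x \in interior C -> (heap x < L)%N) ->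
  exists r, forall omega : {ffun interior C -> spin},
    chain_weight K g c L (fun i => glue omega delta (vert i)) =
    expR (- energy lambda1 lambda2 delta omega) * r.
Proof.
move=> cC hL.
pose F (s : configuration) x := \prod_(b : bool) K (s x) (s (rcons x b)).
exists (((\sum_k g k ^+ 2) * c ^+ L.*2)^-1 * (\prod_(j < L | vert j \notin interior C) F delta (vert j))
   * \prod_(L <= i < L.*2.+1) g (delta (vert i)) ^+ 2) => omega.
rewrite /chain_weight.
have -> : \prod_(L <= i < L.*2.+1) g (glue omega delta (vert i)) ^+ 2 =
    \prod_(L <= i < L.*2.+1) g (delta (vert i)) ^+ 2.
  apply: eq_big_nat => i /andP[Li _]; rewrite glue_out //; apply/negP => /hL.
  by rewrite vertK ltnNge Li.
have -> : \prod_(j < L) \prod_(b : bool)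
    K (glue omega delta (vert j)) (glue omega delta (vert (j.*2 + b).+1)) =
    \prod_(j < L) F (glue omega delta) (vert j).
  by apply: eq_bigr => j _; apply: eq_bigr => b _; rewrite vert_child.
rewrite (bigID (fun j : 'I_L => vert j \in interior C)) /=.
have -> : \prod_(j < L | vert j \notin interior C) F (glue omega delta) (vert j) =
    \prod_(j < L | vert j \notin interior C) F delta (vert j).
  apply: eq_bigr => j jC; apply: eq_bigr => b _; rewrite !glue_out //.
  by apply: contra jC; apply: interior_prefix => //; exact: prefix_rcons.
have -> : \prod_(j < L | vert j \in interior C) F (glue omega delta) (vert j) =
    expR (- energy lambda1 lambda2 delta omega).
  rewrite expR_energy //.
  rewrite -(big_mkord (fun j => vert j \in interior C) (fun j => F (glue omega delta) (vert j))).
  rewrite -big_filter -(big_map vert predT) /=.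
  transitivity (\prod_(x : interior C) F (glue omega delta) (val x)).
    rewrite -(big_seq_fsetE _ (interior C) predT) /=.
    apply: perm_big; apply: uniq_perm; rewrite ?fset_uniq //.
      rewrite map_inj_uniq ?filter_uniq ?iota_uniq //.
      by move=> i j /(congr1 heap); rewrite !vertK.
    move=> x; apply/mapP/idP => [[j]|xC]; first by rewrite mem_filter => /andP[h _] ->.
    by exists (heap x); rewrite ?heapK // mem_filter heapK xC mem_index_iota hL.
  by apply: eq_bigr => x _; rewrite /F glue_val.
by rewrite mulrCA !mulrA.
Qed.

Variable mu : probability config_space R.
Hypothesis mu_chain : forall L (s : nat -> spin),
  mu [set w : config_space | forall i, (i < L.*2.+1)%N -> w (vert i) = s i] = (chain_weight K g c L s)%:E.

Section FixCutset.
Variable C : {fset vertex}.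
Hypothesis cC : cutset C.

Definition inside (omega : {ffun interior C -> spin}) : set config_space :=
  [set w | forall x : interior C, w (val x) = omega x].

Definition outside (L : nat) (delta : configuration) : set config_space :=
  [set w | forall i, (i < L.*2.+1)%N -> vert i \notin interior C -> w (vert i) = delta (vert i)].

Lemma measurable_outside L delta : measurable (outside L delta).
Proof.
apply: (@measurable_local (map vert (iota 0 L.*2.+1))) => w w' ww' /= h i iL iC.
by rewrite -ww' ?h //; apply: map_f; rewrite mem_iota.
Qed.

(** The Gibbs condition for one event, with measurability included so that these events form a
    Dynkin system. *)
Definition agree (omega : {ffun interior C -> spin}) (A : set config_space) : Prop :=
  measurable A /\ mu (inside omega `&` A) =
    (\int[mu]_(delta in A) (finite_volume_gibbs lambda1 lambda2 delta omega)%:E)%E.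

(** The event fixes the spins on C, so the kernel is constant on it, and in the conditional
    probability the common factor r cancels. *)
Lemma outside_agree omega L delta :
  (forall x, x \in interior C -> (heap x < L)%N) -> (forall x, x \in C -> (heap x < L)%N) ->
  agree omega (outside L delta).
Proof.
move=> iL cL; split; first exact: measurable_outside.
have [r hr] := chain_weight_glue delta cC iL.
have muE o : mu (inside o `&` outside L delta) = (expR (- energy lambda1 lambda2 delta o) * r)%:E.
  rewrite -hr -mu_chain; congr (mu _); apply/seteqP; split=> w /=.
    move=> [wi wo] i iL2; case: (boolP (vert i \in interior C)) => iC.
      by rewrite -[vert i]/(val [` iC]%fset) glue_val wi.
    by rewrite glue_out // wo.
  move=> h; split=> [x|i iL2 iC]; last by rewrite h // glue_out.
  rewrite -(glue_val o delta) -[val x]heapK h //.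
  by apply: ltn_trans (iL _ (fsvalP x)) _; rewrite ltnS -addnn leq_addr.
have muO : mu (outside L delta) = (partition_function lambda1 lambda2 C delta * r)%:E.
  rewrite /partition_function mulr_suml -sumEFin.
  under eq_bigr => o _ do rewrite -muE.
  rewrite -(@measure_finType _ _ _ mu _ predT (fun o => inside o `&` outside L delta)).
  - congr (mu _); apply/seteqP; split=> w; last by move=> [om _ []].
    by move=> wo; exists [ffun x => w (val x)] => //; split=> // x; rewrite ffunE.
  - move=> o; apply: measurableI; [exact: measurable_interior_event|exact: measurable_outside].
  - move=> o o' [w [wo wo']]; case: wo wo' => h _ [h' _]; apply/ffunP => x; by rewrite -(h x) -(h' x).
transitivity (\int[mu]_(w in outside L delta) (cst (finite_volume_gibbs lambda1 lambda2 delta omega)%:E w))%E.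
  rewrite integral_cst ?measurable_outside //; last exact: measurable_outside.
  have h := muO.
  rewrite [X in (_ = _ * X)%E](_ : _ = (partition_function lambda1 lambda2 C delta * r)%:E) //.
  rewrite muE -EFinM /finite_volume_gibbs; congr (_%:E).
  by rewrite mulrA divfK // gt_eqF // partition_function_gt0.
apply: eq_integral => w; rewrite inE => wo; congr (_%:E).
apply: finite_volume_gibbs_local => x xC; rewrite -[x]heapK wo ?heapK //.
  by apply: ltn_trans (cL _ xC) _; rewrite ltnS -addnn leq_addr.
by apply/negP => /(interior_notin cC); rewrite xC.
Qed.

Lemma agree_bigcup omega (F : (set config_space)^nat) : trivIset setT F ->
  (forall n, agree omega (F n)) -> agree omega (\bigcup_k F k).
Proof.
move=> tF aF; have mF n : measurable (F n) by case: (aF n).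
have mIF n : measurable (inside omega `&` F n).
  by apply: measurableI; [exact: measurable_interior_event|].
split; first exact: bigcup_measurable.
rewrite setI_bigcupr measure_semi_bigcup //; last 2 first.
- exact: trivIset_setIl.
- exact: bigcupT_measurable.
rewrite ge0_integral_bigcup //.
- by apply: eq_eseriesr => n _; case: (aF n).
- by apply: measurable_funTS; exact: measurable_finite_volume_gibbs.
- by move=> w _; rewrite lee_fin finite_volume_gibbs_ge0.
Qed.

Lemma agree0 omega : agree omega set0.
Proof. by split=> //; rewrite setI0 measure0 integral_set0. Qed.

Lemma agree_finType omega (I : finType) (F : I -> set config_space) :
  (forall i j, F i `&` F j !=set0 -> i = j) -> (forall i, agree omega (F i)) ->
  agree omega (\bigcup_i F i).
Proof.
move=> tF aF.
(* The finite family becomes a sequence padded with empty sets. *)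
pose G n : set config_space := if insub n is Some i then F (enum_val (i : 'I_#|I|)) else set0.
have -> : \bigcup_i F i = \bigcup_n G n.
  apply/seteqP; split=> w [].
    move=> i _ Fw; exists (enum_rank i) => //; rewrite /G insubT // => h.
    by rewrite (_ : Sub _ _ = enum_rank i) ?enum_rankK //; apply: val_inj.
  by move=> n _; rewrite /G; case: insubP => // i _ _ Fw; exists (enum_val i).
apply: agree_bigcup => [m n _ _ [w []]|n]; last first.
  by rewrite /G; case: insubP => // *; exact: agree0.
rewrite /G; case: insubP => // i _ <-; case: insubP => // j _ <- Fi Fj.
by congr (val _); apply: enum_val_inj; apply: tF; exists w.
Qed.

Lemma agree_setC omega A : agree omega setT -> agree omega A -> agree omega (~` A).
Proof.
move=> [_ aT] [mA aA]; split; first exact: measurableC.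
have mI := measurable_interior_event omega.
have mf := measurable_finite_volume_gibbs lambda1 lambda2 omega.
move: aT; rewrite setIT -(setUv A) ge0_integral_setU //; first last.
- by apply/disj_setPS; rewrite setICr.
- by move=> w _; rewrite lee_fin finite_volume_gibbs_ge0.
- exact: measurable_funTS.
- exact: measurableC.
rewrite -aA (measureDI mu mI mA) setDE addeC => h.
have fin : mu (inside omega `&` A) \is a fin_num.
  by rewrite fin_num_measure //; exact: measurableI.
exact: (adde_fin_inj fin h).
Qed.

Variable L0 : nat.
Hypothesis interior_L0 : forall x, x \in interior C -> (heap x < L0)%N.
Hypothesis C_L0 : forall x, x \in C -> (heap x < L0)%N.

Definition outer L : seq vertex := [seq v <- map vert (iota 0 L.*2.+1) | v \notin interior C].

Lemma mem_outer L v : (v \in outer L) = (heap v < L.*2.+1)%N && (v \notin interior C).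
Proof.
rewrite mem_filter andbC; congr (_ && _); apply/mapP/idP => [[i + ->]|vL].
  by rewrite mem_iota vertK.
by exists (heap v); rewrite ?heapK // mem_iota.
Qed.

Definition local_event L (A : set config_space) : Prop :=
  forall w w' : configuration, {in outer L, w =1 w'} -> A w -> A w'.

(** A local event is a finite disjoint union of events fixing all exterior spins up to index 2 L. *)
Lemma agree_local omega L A : (L0 <= L)%N -> local_event L A -> agree omega A.
Proof.
move=> LL loc.
pose ext (rho : {ffun 'I_L.*2.+1 -> spin}) : configuration :=
  fun v => if insub (heap v) is Some i then rho i else ord0.
have extE rho (i : 'I_L.*2.+1) : ext rho (vert i) = rho i by rewrite /ext vertK valK.
(* Setting rho to 0 on the interior makes distinct rho give disjoint events. *)
pose P (rho : {ffun 'I_L.*2.+1 -> spin}) := [forall i : 'I_L.*2.+1, (vert i \in interior C) ==> (rho i == ord0)] && `[< A (ext rho) >].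
pose F rho : set config_space := if P rho then outside L (ext rho) else set0.
have loc_outside (w w' : configuration) : outside L w w' -> {in outer L, w =1 w'}.
  by move=> h v; rewrite mem_outer => /andP[vL vC]; rewrite -[v]heapK h ?heapK.
have -> : A = \bigcup_rho F rho.
  apply/seteqP; split=> w; last first.
    move=> [rho _]; rewrite /F; case: ifP => // /andP[_ /asboolP Ae] /loc_outside h.
    exact: loc Ae.
  move=> Aw; pose rho : {ffun 'I_L.*2.+1 -> spin} := [ffun i : 'I_L.*2.+1 => if vert i \in interior C then ord0 else w (vert i)].
  have wo : outside L (ext rho) w.
    by move=> i iL iC; rewrite (extE rho (Ordinal iL)) ffunE (negPf iC).
  exists rho => //; rewrite /F ifT //; apply/andP; split.
    by apply/forallP => i; apply/implyP => iC; rewrite ffunE iC.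
  by apply/asboolP; apply: loc Aw => v vL; rewrite (loc_outside _ _ wo).
apply: agree_finType => [rho rho' [w []]|rho]; last first.
  rewrite /F; case: ifP => _; last exact: agree0.
  apply: outside_agree => x xC; apply: leq_trans LL; [exact: interior_L0|exact: C_L0].
rewrite /F; case: ifP => // /andP[/forallP h _] wo; case: ifP => // /andP[/forallP h' _] wo'.
apply/ffunP => i; case: (boolP (vert i \in interior C)) => iC.
  by move: (implyP (h i) iC) (implyP (h' i) iC) => /eqP-> /eqP->.
by rewrite -(extE rho) -(extE rho') -wo // -wo'.
Qed.

(** Dynkin's pi-lambda theorem: local events are stable under intersection and contain the exterior
    cylinders. *)
Lemma agree_sigma omega A : <<s cylinders (~` [set` interior C]) >> A -> agree omega A.
Proof.
pose G := [set A : set config_space | exists2 L, (L0 <= L)%N & local_event L A].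
have GI : setI_closed G.
  move=> A1 A2 [L1 h1 l1] [L2 h2 l2]; exists (maxn L1 L2); first by rewrite leq_max h1.
  move=> w w' ww' [a1 a2]; split.
    apply: l1 a1 => v; rewrite mem_outer => /andP[vL vC]; apply: ww'; rewrite mem_outer vC andbT.
    by apply: leq_trans vL _; rewrite ltnS leq_double leq_maxl.
  apply: l2 a2 => v; rewrite mem_outer => /andP[vL vC]; apply: ww'; rewrite mem_outer vC andbT.
  by apply: leq_trans vL _; rewrite ltnS leq_double leq_maxr.
have Gagree B : G B -> agree omega B by move=> [L LL]; exact: agree_local.
have aT : agree omega setT by apply: Gagree; exists L0.
have dyn : dynkin (agree omega).
  split=> //; first by move=> B; exact: agree_setC.
  by move=> F tF; exact: agree_bigcup.
move=> sA; have : <<d G >> A.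
  rewrite setI_closed_g_dynkin_g_sigma_algebra //.
  apply: sub_sigma_algebra2 sA => _ [v vC [k ->]].
  exists (maxn L0 (heap v)); first by rewrite leq_maxl.
  move=> w w' ww' /= <-; rewrite -ww' // mem_outer; apply/andP; split; last exact/negP.
  by rewrite ltnS; apply: leq_trans (leq_maxr L0 _) _; rewrite -addnn leq_addr.
by apply: smallest_sub.
Qed.

End FixCutset.

Lemma chain_gibbs : gibbs_measure lambda1 lambda2 mu.
Proof.
move=> C cC omega A sA.
pose L0 := (\max_(x <- enum_fset (interior C) ++ enum_fset C) heap x).+1.
have hL x : x \in enum_fset (interior C) ++ enum_fset C -> (heap x < L0)%N.
  by move=> xs; rewrite ltnS; exact: (@leq_bigmax_seq _ _ predT heap).
have iL0 x : x \in interior C -> (heap x < L0)%N by move=> xC; apply: hL; rewrite mem_cat xC.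
have cL0 x : x \in C -> (heap x < L0)%N by move=> xC; apply: hL; rewrite mem_cat orbC xC.
by have [] := agree_sigma cC iL0 cL0 omega sA.
Qed.

End GibbsChain.

(** * A non-constant boundary law and the conclusion *)

Lemma boundary_law_exists (R : realType) (l : R) : 3^-1 < l -> l < 2^-1 ->
  exists (g : spin -> R) (c : R), [/\ forall k, 0 < g k, 0 < c, g k2 < g k0 &
    forall k, \sum_j M 2%:R^-1 l k j * g j ^+ 2 = c * g k].
Proof.
move=> l3 l2.
have l1 : 0 < 1 + l by lra.
(* With g = (n, s, t, z) = (1, x/2, x/2, z), the equation M g^2 = c g reads c = 1 + z, x^2 = 2 z (1
   - z) and l (3 - z) = 1 + z. The last solution z is positive exactly because l > 1/3. *)
have [z [z0 z1 zE]] : exists z, [/\ 0 < z, z < 1 & l * (3 - z) = 1 + z].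
  exists ((3 * l - 1) / (1 + l)); split; last by field; rewrite gt_eqF.
    by rewrite divr_gt0 //; lra.
  by rewrite ltr_pdivrMr //; lra.
pose x := Num.sqrt (2 * z * (1 - z)).
have xx : x ^+ 2 = 2 * z * (1 - z) by rewrite sqr_sqrtr // !mulr_ge0 //; lra.
have x0 : 0 < x by rewrite sqrtr_gt0 !mulr_gt0 //; lra.
have xz : x < 1 + z.
  rewrite -(@ltr_pXn2r _ 2) ?nnegrE ?(ltW x0) //; last lra.
  rewrite xx; nra.
pose g (k : spin) : R := match val k with 0%N => 1 + z + x | 2 => 1 + z - x | _ => 1 - z end.
exists g, (1 + z); split.
- by apply: spin_ind; rewrite /g /=; lra.
- lra.
- by rewrite /g /=; lra.
have [t0 t1 t2 t3] := transferE l (fun j => g j ^+ 2).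
have e1 : g k0 ^+ 2 = (1 + z) ^+ 2 + 2 * (1 + z) * x + 2 * z * (1 - z) by rewrite -xx /g /=; ring.
have e2 : g k2 ^+ 2 = (1 + z) ^+ 2 - 2 * (1 + z) * x + 2 * z * (1 - z) by rewrite -xx /g /=; ring.
have lz : l * z = 3 * l - 1 - z by lra.
have lzz : l * z ^+ 2 = 3 * (l * z) - z - z ^+ 2 by have := congr1 (fun y => y * z) lz; rewrite /=; lra.
by apply: spin_ind; rewrite -/(transfer l (fun j => g j ^+ 2) _) ?t0 ?t1 ?t2 ?t3 e1 e2 /g /=; nra.
Qed.

Lemma nonuniform_gibbs_exists (R : realType) (l : R) :
  (forall i j, 0 < M 2%:R^-1 l i j) -> 3^-1 < l -> l < 2^-1 ->
  exists mu : probability config_space R, gibbs_measure 2%:R^-1 l mu /\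
     marginal mu origin <> equidistribution.
Proof.
move=> M0 l3 l2; have [g [c [g0 c0 g20 law]]] := boundary_law_exists l3 l2.
pose K : spin -> spin -> R := fun_of_matrix (M 2%:R^-1 l).
have [mu hmu] := exists_process (chain_step_ge0 M0 g0 c0) (chain_step_sum g0 c0 law) vertK.
have mu_chain L s : mu [set w : config_space | forall i, (i < L.*2.+1)%N -> w (vert i) = s i]%classic =
    (chain_weight K g c L s)%:E.
  by rewrite hmu (chain_weightE K g0 c0).
exists mu; split; first exact: (chain_gibbs M0 mu_chain).
move=> uni.
(* For L = 0 the chain weight is the law of the root alone, proportional to g^2; it is not uniform
   as g(2) < g(0). *)
have marg k : marginal mu origin k = (chain_weight K g c 0 (fun=> k))%:E.
  rewrite -mu_chain; congr (mu _); apply/seteqP; split=> w /=.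
    move=> wk i; rewrite double0 ltnS leqn0 => /eqP ->.
    by rewrite (_ : vert 0 = origin) //; exact: (heapK origin).
  by move/(_ 0%N isT); rewrite (_ : vert 0 = origin) //; exact: (heapK origin).
have := marg k0; have := marg k2; rewrite uni /equidistribution => -[->] [].
rewrite /chain_weight !big_ord0 !big_nat1 => /mulfI E.
have {}E : g k2 ^+ 2 = g k0 ^+ 2.
  apply: E; rewrite mulr1 invr_eq0 mulf_neq0 ?expf_neq0 ?(gt_eqF c0) //.
  by rewrite gt_eqF // sum_sqr_gt0.
by move: g20; rewrite -(@ltr_pXn2r _ 2) ?nnegrE ?ltW // E ltxx.
Qed.

Theorem theorem4p2 (R : realType) (lambda1 lambda2 : R)
    (hmodel : generalized_clock_model lambda1 lambda2)
    (hlambda1 : lambda1 = 2%:R^-1) :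
  (exists mu : probability config_space R,
      gibbs_measure lambda1 lambda2 mu /\
      exists v : vertex, marginal mu v <> equidistribution)
  <-> 3%:R^-1 < lambda2 < 2%:R^-1.
Proof.
subst lambda1; have [M0 _ _] := hmodel; split=> [[mu [gm [v mv]]]|/andP[l3 l2]].
  rewrite (clock_model_lt_half hmodel) andbT ltNge; apply/negP => l3; apply: mv.
  by apply: gibbs_marginal_uniform gm => //; [exact: clock_model_gt0 hmodel|lra].
have [mu [gm mo]] := nonuniform_gibbs_exists M0 l3 l2.
by exists mu; split=> //; exists origin.
Qed.
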